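(* Let $V\simeq\mathbb{C}^n$ and $a_\bullet\colon 0<a_1<\dots<a_t<n$. Let $(w^1,\dots,w^s)$ be a Schubert problem for $\mathbb{F}\ell(a_\bullet,V)$ and suppose that $F^1_\bullet,\dots,F^s_\bullet$ are general (complete) flags given by invertible $n\times n$ matrices $\Phi^1,\dots,\Phi^s$, so that $F^i_\bullet=R_\bullet(\Phi^i)$. Then the system of equations $$(M\Phi^s)(\Phi^i)^{-1}N_i\;=\;0_{a_\bullet}\qquad\text{for } i=1,\dots,s-1,$$ where $(M,N_1,\dots,N_{s-1})\in\mathcal{M}_{w^s}\times\mathcal{N}_{w^1}\times\dots\times\mathcal{N}_{w^{s-1}}$, defines the instance $$X_{w^1}F^1_\bullet\cap X_{w^2}F^2_\bullet\cap\dots\cap X_{w^s}F^s_\bullet$$ of the Schubert problem (via $(M,N_1,\dots,N_{s-1})\mapsto R_{a_\bullet}(M\Phi^s)$, which identifies the set of common zeroes bijectively with the points of the intersection) as the common zeroes of $(s-1)\cdot\dim(a_\bullet)$ bilinear equations in $(s-1)\cdot\dim(a_\bullet)$ variables, exhibiting the Schubert problem as a square system of equations.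
   Context: Flag manifolds. $V$ is a complex vector space with basis $e_1,\dots,e_n$ corresponding to columns of matrices, $[n]=\{1,\dots,n\}$. $\mathbb{F}\ell(a_\bullet,V)$ is the manifold of partial flags $V_{a_\bullet}\colon V_{a_1}\subsetneq\dots\subsetneq V_{a_t}\subsetneq V$ with $\dim V_{a_i}=a_i$; with $a_0=0$ its dimension is $\dim(a_\bullet)=\sum_{i=1}^t(a_i-a_{i-1})(n-a_i)$. For a full rank matrix $M$ with $n$ columns and at least $a_t$ rows, $R_{a_\bullet}(M)$ is the flag whose $a_i$-dimensional member is the span of the first $a_i$ rows of $M$; for an invertible $n\times n$ matrix $\Phi$, $R_\bullet(\Phi)$ is the complete flag whose $i$-dimensional member is the span of the first $i$ rows. Schubert varieties. $W^{a_\bullet}=\{w\in S_n: w(i)<w(i+1)\text{ whenever } i\notin a_\bullet\}$ ($i\in[n-1]$). For $w\in W^{a_\bullet}$ and a complete flag $F_\bullet$, $$X_wF_\bullet=\{V_{a_\bullet}:\dim(V_{a_i}\cap F_j)\ge\#\{k\le a_i: w(k)\le j\}\text{ for all } i\in[t],\,j\in[n]\}.$$ The length is $\ell(w)=\#\{(i,k): k>i,\ w(k)<w(i)\}$ and the codimension of $X_wF_\bullet$ is $|w|=\dim(a_\bullet)-\ell(w)$. A Schubert problem on $\mathbb{F}\ell(a_\bullet,V)$ is a list $w^1,\dots,w^s\in W^{a_\bullet}$ with $|w^1|+\dots+|w^s|=\dim(a_\bullet)$. ''General flags'' means that $(F^1_\bullet,\dots,F^s_\bullet)$ lies in a suitable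 dense Zariski open subset of the product of $s$ copies of the variety of complete flags. Local coordinates. For $w\in W^{a_\bullet}$, $\mathcal{M}_w$ is the set of $a_t\times n$ matrices $(m_{i,j})$ with $m_{i,j}=1$ if $j=w(i)$; $m_{i,j}=0$ if $j>w(i)$ or $j=w(k)$ for some $k<i$; all other entries free. It is an affine space of dimension $\ell(w)$. Let $w_0\in S_n$, $w_0(i)=n+1-i$ (also its permutation matrix), and $a_\bullet^r\colon n-a_t<n-a_{t-1}<\dots<n-a_1$. If $w\in W^{a_\bullet}$ then $w_0ww_0\in W^{a_\bullet^r}$, so (applying the definition of $\mathcal M$ with $a_\bullet^r$ in place of $a_\bullet$) $\mathcal{M}_{w_0ww_0}$ is a set of $(n-a_1)\times n$ matrices; define $\mathcal{N}_w=\{(M\cdot w_0)^T: M\in\mathcal{M}_{w_0ww_0}\}$, i.e. reverse the order of the columns and transpose, giving $n\times(n-a_1)$ matrices. The free entries are the variables. Equations. For an $a_t\times n$ matrix $A$ and an $n\times(n-a_1)$ matrix $B$, ''$AB=0_{a_\bullet}$'' denotes the set of $\dim(a_\bullet)$ bilinear equations $\mathrm{row}_i(A)\cdot\mathrm{col}_j(B)=0$ for those pairs $(i,j)$ such that there is some $k\in[t]$ with $i\le a_k$ and $j\le n-a_k$. *)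

(* Defs.v *)
From mathcomp Require Import all_boot all_order all_algebra perm.
From mathcomp Require Import boolp classical_sets functions reals.
From mathcomp Require Import complex mpoly.

Set Implicit Arguments.
Unset Printing Implicit Defensive.

Import GRing.Theory.
Local Open Scope ring_scope.

(* Indices are 0-based: the 1-based w(i) = j is w (i-1) = j-1 here, and row i  *)
(* of a matrix is row (i-1).  The dimensions a_1 < ... < a_t are the sequence  *)
(* a = [:: a_1; ...; a_t] (not shifted), so a_t = last 0 a.                   *)

Section Combinatorics.
Local Open Scope nat_scope.

Definition flag_dims (n : nat) (a : seq nat) : bool :=
  (a != [::]) && path ltn 0 (rcons a n).

Definition dim_flags (n : nat) (a : seq nat) : nat :=
  \sum_(i < size a) (nth 0 a i - nth 0 (0 :: a) i) * (n - nth 0 a i).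

Definition dual_dims (n : nat) (a : seq nat) : seq nat :=
  rev [seq n - d | d <- a].

(* The 0-based position i and its successor i.+1 are the positions i.+1 and    *)
(* i.+2 of the 1-based convention, hence the test on the nat i.+1 = j.         *)
Definition in_Wa (n : nat) (a : seq nat) (w : 'S_n) : Prop :=
  forall i j : 'I_n, j = i.+1 :> nat -> nat_of_ord j \notin a -> w i < w j.

Definition perm_length (n : nat) (w : 'S_n) : nat :=
  #|[set p : 'I_n * 'I_n | (p.1 < p.2) && (w p.2 < w p.1)]|.

(* For w in W^a one has perm_length w <= dim_flags n a, so the subtraction is  *)
(* not truncated.                                                              *)
Definition codim (n : nat) (a : seq nat) (w : 'S_n) : nat :=
  dim_flags n a - perm_length w.

Definition schubert_problem (n : nat) (a : seq nat) (s : nat)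
    (w : 'I_s -> 'S_n) : Prop :=
  (forall i, in_Wa a (w i)) /\ \sum_(i < s) codim a (w i) = dim_flags n a.

Definition w0 (n : nat) : 'S_n := perm (@rev_ord_inj n).

(* The value of w at a natural number i, with w extended by the identity       *)
(* outside 'I_n; it is only used for i < n.                                    *)
Definition perm_nat (n : nat) (w : 'S_n) (i : nat) : nat :=
  if insub i is Some k then w k else i.

Definition is_one (n : nat) (a : seq nat) (w : 'S_n)
    (i : 'I_(last 0 a)) (j : 'I_n) : bool :=
  j == perm_nat w i :> nat.

Definition is_zero (n : nat) (a : seq nat) (w : 'S_n)
    (i : 'I_(last 0 a)) (j : 'I_n) : bool :=
  (perm_nat w i < j) ||
  [exists k : 'I_(last 0 a), (k < i) && (j == perm_nat w k :> nat)].

Definition is_free (n : nat) (a : seq nat) (w : 'S_n)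
    (i : 'I_(last 0 a)) (j : 'I_n) : bool :=
  ~~ is_one a w i j && ~~ is_zero a w i j.

(* The pairs (i, j) such that row_i(A) . col_j(B) = 0 is one of the equations  *)
(* AB = 0_a.  The number of columns last 0 (dual_dims n a) of B is n - a_1.    *)
Definition zero_index (n : nat) (a : seq nat) :
    {set 'I_(last 0 a) * 'I_(last 0 (dual_dims n a))} :=
  [set p : 'I_(last 0 a) * 'I_(last 0 (dual_dims n a)) |
     has (fun d : nat => (p.1 < d) && (p.2 < n - d)) a].

Definition equations (n : nat) (a : seq nat) (r : nat) :
    {set 'I_r * ('I_(last 0 a) * 'I_(last 0 (dual_dims n a)))} :=
  finset.setX [set: 'I_r]%SET (zero_index n a).

(* Positions of entries in (M, N_1, ..., N_r).                                 *)
Definition entry_position (n : nat) (a : seq nat) (r : nat) : finType :=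
  (('I_(last 0 a) * 'I_n) + ('I_r * ('I_n * 'I_(last 0 (dual_dims n a)))))%type.

(* Entry (p, q) of (M w0)^T is entry (q, w0 p) of M.                           *)
Definition variables (n : nat) (a : seq nat) (r : nat) (w : 'I_r.+1 -> 'S_n) :
    {set entry_position n a r} :=
  [set v : entry_position n a r |
    match v with
    | inl (i, j) => is_free a (w ord_max) i j
    | inr (l, (p, q)) =>
        is_free (dual_dims n a)
          (w0 n * w (widen_ord (leqnSn r) l) * w0 n)%g q (w0 n p)
    end].

End Combinatorics.

Section Geometry.
Variable K : fieldType.
Local Open Scope classical_set_scope.

Definition row_span (m n : nat) (A : 'M[K]_(m, n)) (d : nat) :
    {vspace 'rV[K]_n} :=
  <<[seq row i A | i : 'I_m <- enum 'I_m & (i < d)%N]>>%VS.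

Definition subspaces (t n : nat) : Type := 'I_t -> {vspace 'rV[K]_n}.

Definition partial_flag (n : nat) (a : seq nat) : set (subspaces (size a) n) :=
  [set V : subspaces (size a) n |
     (forall i : 'I_(size a), \dim (V i) = nth 0%N a i) /\
     (forall i j : 'I_(size a), (i <= j)%N -> (V i <= V j)%VS)].

(* A complete flag F lists its members of dimensions 1, ..., n: the member of  *)
(* dimension j.+1 is F j.                                                      *)
Definition complete_flag (n : nat) : set (subspaces n n) :=
  [set F : subspaces n n |
     (forall j : 'I_n, \dim (F j) = j.+1) /\
     (forall i j : 'I_n, (i <= j)%N -> (F i <= F j)%VS)].

Definition R_flag (n : nat) (a : seq nat) (m : nat) (A : 'M[K]_(m, n)) :
    subspaces (size a) n :=
  fun i => row_span A (nth 0%N a i).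

Definition R_complete (n : nat) (Phi : 'M[K]_n) : subspaces n n :=
  fun j => row_span Phi j.+1.

Definition schubert_variety (n : nat) (a : seq nat) (w : 'S_n)
    (F : subspaces n n) : set (subspaces (size a) n) :=
  [set V | partial_flag a V /\
    forall (i : 'I_(size a)) (j : 'I_n),
      (#|[pred k : 'I_n | (k < nth 0 a i) && (w k <= j)]|
         <= \dim (V i :&: F j)%VS)%N].

Definition local_M (n : nat) (a : seq nat) (w : 'S_n) :
    set 'M[K]_(last 0%N a, n) :=
  [set M : 'M[K]_(last 0%N a, n) |
     forall i j, (is_one a w i j -> M i j = 1) /\
                  (is_zero a w i j -> M i j = 0)].

Definition local_N (n : nat) (a : seq nat) (w : 'S_n) :
    set 'M[K]_(n, last 0%N (dual_dims n a)) :=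
  [set (M *m perm_mx (w0 n))^T |
     M in local_M (dual_dims n a) (w0 n * w * w0 n)%g].

(* Tuples (M, N_1, ..., N_r); the list of permutations has r.+1 elements, the  *)
(* last of which gives M.                                                      *)
Definition coordinates (n : nat) (a : seq nat) (r : nat) : Type :=
  ('M[K]_(last 0%N a, n) * ('I_r -> 'M[K]_(n, last 0%N (dual_dims n a))))%type.

Definition local_coordinates (n : nat) (a : seq nat) (r : nat)
    (w : 'I_r.+1 -> 'S_n) : set (coordinates n a r) :=
  [set x | local_M a (w ord_max) x.1 /\
           forall i : 'I_r, local_N a (w (widen_ord (leqnSn r) i)) (x.2 i)].

Arguments local_coordinates {n} a {r} w _.

Definition entry (n : nat) (a : seq nat) (r : nat) (x : coordinates n a r)
    (v : entry_position n a r) : K :=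
  match v with
  | inl (i, j) => x.1 i j
  | inr (l, (p, q)) => x.2 l p q
  end.

(* The left-hand side row_i(M Phi^s (Phi^l)^-1) . col_j(N_l), e = (l, (i, j)). *)
Definition equation_lhs (n : nat) (a : seq nat) (r : nat)
    (Phi : 'I_r.+1 -> 'M[K]_n)
    (e : 'I_r * ('I_(last 0%N a) * 'I_(last 0%N (dual_dims n a))))
    (M : 'M[K]_(last 0%N a, n)) (N : 'M[K]_(n, last 0%N (dual_dims n a))) : K :=
  (M *m Phi ord_max *m invmx (Phi (widen_ord (leqnSn r) e.1)) *m N) e.2.1 e.2.2.

Definition common_zeroes (n : nat) (a : seq nat) (r : nat)
    (w : 'I_r.+1 -> 'S_n) (Phi : 'I_r.+1 -> 'M[K]_n) :
    set (coordinates n a r) :=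
  [set x | local_coordinates a w x /\
     forall e, e \in equations n a r -> equation_lhs a Phi e x.1 (x.2 e.1) = 0].

Arguments common_zeroes {n} a {r} w Phi _.

(* Zariski topology on the product of s copies of the variety of complete      *)
(* flags: the quotient topology for the map (Phi^i)_i |-> (R_complete Phi^i)_i *)
(* from GL_n^s, i.e. the topology of (GL_n / B)^s, where GL_n^s is open in the *)
(* affine space of s-tuples of n x n matrices.                                 *)

Definition tuple_coords (n s : nat) (Phi : 'I_s -> 'M[K]_n) :
    'I_#|{: 'I_s * ('I_n * 'I_n)}| -> K :=
  fun k => let: (i, (p, q)) := enum_val k in Phi i p q.

Definition zariski_open (n s : nat) (U : set ('I_s -> subspaces n n)) : Prop :=
  U `<=` [set F | forall i, complete_flag (F i)] /\
  exists P : set {mpoly K[#|{: 'I_s * ('I_n * 'I_n)}|]},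
    forall Phi : 'I_s -> 'M[K]_n, (forall i, Phi i \in unitmx) ->
      (U (fun i => R_complete (Phi i)) <->
       exists2 p, P p & p.@[tuple_coords Phi] != 0).

Definition zariski_dense (n s : nat) (U : set ('I_s -> subspaces n n)) : Prop :=
  forall O, zariski_open O -> O !=set0 -> (O `&` U) !=set0.

End Geometry.

Arguments row_span {K m n} A d.
Arguments R_flag {K n} a {m} A _.
Arguments R_complete {K n} Phi _.
Arguments local_M {K n} a w _.
Arguments local_N {K n} a w _.
Arguments local_coordinates {K n} a {r} w _.
Arguments equation_lhs {K n} a {r} Phi e M N.
Arguments common_zeroes {K n} a {r} w Phi _.
Arguments tuple_coords {K n s} Phi _.

(* Main.v *)
Require Import Defs.
From mathcomp Require Import all_boot all_order all_algebra perm.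
From mathcomp Require Import boolp classical_sets functions reals.
From mathcomp Require Import complex mpoly.
From mathcomp Require Import zify.

Set Implicit Arguments.
Unset Strict Implicit.
Unset Printing Implicit Defensive.

Import GRing.Theory.
Local Open Scope ring_scope.

(** Relative to a complete flag, every partial flag is spanned by the first rows
of a unique matrix of some M_v, with v in W^a, and it lies in X_w exactly when
the rank function of v dominates that of w; then v = w or l(v) < l(w).  Hence
M_w and N_w parametrize the open cell of X_w, once by spanning rows and once by
annihilating columns: if A in M_v and B in N_w satisfy AB = 0_a then
v({1..d}) = w({1..d}) for all d in a, so v = w.  The common zeroes are thus the
intersection of the open cells.

It remains to see that for general flags the whole intersection lies in the open
cells.  A point outside lies in cells of permutations v^i whose lengths have a
sum smaller than (s-1) dim(a).  The tuples (Phi^i) admitting such a point are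
covered by finitely many images of polynomial maps from affine spaces of
dimension less than s n^2, and counting monomials yields a nonzero polynomial
vanishing on all of them. *)

(** * Spans of rows *)

Section RowSpans.
Variable K : fieldType.

(** The count behind genericity is tight. A point V costs the l(u) parameters of its own cell u
    relative to the standard flag, at most dim(a). Given V, a matrix Phi^k placing V in the cell v^k
    costs l(v^k) for a reduced matrix, plus n^2 - dim(a) for a block triangular matrix respecting V.
    With v^k = w^k for all k and l(u) = dim(a), the total is exactly s n^2; a single smaller cell
    brings it below. Two points shape the rest. The conditions of X_w concern only the dimensions in
    a, while comparing lengths needs ranks at every position; membership in W^a bridges the two. And
    a row of a matrix in M_v ends at its pivot while a column of a matrix in N_w begins at its
    pivot, so the product of a row and a column with the same pivot is 1. This makes the bilinear
    equations detect the cell. *)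

Definition span_rows m n (S : pred 'I_m) (A : 'M[K]_(m, n)) : {vspace 'rV[K]_n} :=
  <<[seq row i A | i <- enum 'I_m & S i]>>%VS.

Lemma mem_span_rows m n (S : pred 'I_m) (A : 'M[K]_(m, n)) i :
  S i -> row i A \in span_rows S A.
Proof. by move=> Si; apply/memv_span/map_f; rewrite mem_filter Si mem_enum. Qed.

Lemma span_rows_subP m n (S : pred 'I_m) (A : 'M[K]_(m, n)) (W : {vspace 'rV[K]_n}) :
  reflect (forall i, S i -> row i A \in W) (span_rows S A <= W)%VS.
Proof.
apply: (iffP idP) => [/subvP sub i Si | h]; first by apply/sub/mem_span_rows.
apply/span_subvP => u u_row; have [i + ->] := mapP u_row.
by rewrite mem_filter => /andP[/h].
Qed.

Lemma span_rowsP m n (S : pred 'I_m) (A : 'M[K]_(m, n)) v :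
  reflect (exists2 c : 'rV_m, (forall i, ~~ S i -> c 0 i = 0) & v = c *m A)
          (v \in span_rows S A).
Proof.
apply: (iffP idP) => [|[c c0 ->]].
  pose B : 'M_(m, n) := diag_mx (\row_i (S i)%:R) *m A.
  pose f := linfun (mulmxr B : 'rV_m -> 'rV_n).
  have sub : (span_rows S A <= limg f)%VS.
    apply/span_rows_subP => i Si; apply/memv_imgP; exists (delta_mx 0 i);
      rewrite ?memvf // lfunE /=.
    by rewrite -rowE /B mul_diag_mx; apply/rowP => l; rewrite !mxE Si mul1r.
  move=> /(subvP sub)/memv_imgP[c _ ->]; rewrite lfunE /=.
  exists (c *m diag_mx (\row_i (S i)%:R)); last by rewrite mulmxA.
  by move=> i /negPf nSi; rewrite mul_mx_diag !mxE nSi mulr0.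
rewrite mulmx_sum_row; apply: memv_suml => i _.
case: (boolP (S i)) => [Si|/c0 ->]; last by rewrite scale0r mem0v.
exact/memvZ/mem_span_rows.
Qed.

Lemma row_spanP m n (A : 'M[K]_(m, n)) d v :
  reflect (exists2 c : 'rV_m, (forall i : 'I_m, (d <= i)%N -> c 0 i = 0) & v = c *m A)
          (v \in row_span A d).
Proof.
apply: (iffP (span_rowsP (fun i : 'I_m => (i < d)%N) A v)) => -[c c0 ->]; exists c => // i.
  by rewrite leqNgt => /c0.
by rewrite -leqNgt => /c0.
Qed.

Lemma mem_row_span m n (A : 'M[K]_(m, n)) d (i : 'I_m) :
  (i < d)%N -> row i A \in row_span A d.
Proof. exact: (@mem_span_rows _ _ (fun i : 'I_m => (i < d)%N)). Qed.

Lemma row_span_subP m n (A : 'M[K]_(m, n)) d (W : {vspace 'rV[K]_n}) :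
  reflect (forall i : 'I_m, (i < d)%N -> row i A \in W) (row_span A d <= W)%VS.
Proof. exact: (@span_rows_subP _ _ (fun i : 'I_m => (i < d)%N)). Qed.

Lemma row_spanS m n (A : 'M[K]_(m, n)) d e :
  (d <= e)%N -> (row_span A d <= row_span A e)%VS.
Proof.
by move=> le_de; apply/row_span_subP => i lt_id; apply: mem_row_span; apply: leq_trans le_de.
Qed.

(** The rows in S and those outside S span spaces of dimension at most the respective cardinalities;
    together these generate dimension m, so both bounds are attained. *)
Lemma dim_span_rows m n (S : pred 'I_m) (A : 'M[K]_(m, n)) :
  row_free A -> \dim (span_rows S A) = #|S|.
Proof.
move=> freeA.
have le_card (S' : pred 'I_m) : (\dim (span_rows S' A) <= #|S'|)%N.
  by apply: leq_trans (dim_span _) _; rewrite size_map cardE enumT.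
pose f := linfun (mulmxr A : 'rV_m -> 'rV_n).
have kerf : lker f == 0%VS.
  by apply/lker0P => u v; rewrite !lfunE; apply: row_free_inj.
have dimf : \dim (limg f) = m.
  rewrite limg_dim_eq; first by rewrite dimvf dim_matrix; exact: mul1n.
  by rewrite (eqP kerf) capv0.
have sub : (limg f <= span_rows S A + span_rows (predC S) A)%VS.
  apply/subvP => _ /memv_imgP[c _ ->]; rewrite lfunE /= mulmx_sum_row.
  apply: memv_suml => i _; apply: memvZ.
  case: (boolP (S i)) => Si.
    exact/(subvP (addvSl _ _))/mem_span_rows.
  exact/(subvP (addvSr _ _))/mem_span_rows.
have cardS : (#|S| + #|predC S| = m)%N by rewrite -[RHS]card_ord -(cardC S).
apply/eqP; rewrite eqn_leq le_card -(leq_add2r #|predC S|) cardS.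
rewrite -[X in (X <= _)%N]dimf; apply: leq_trans (dimvS sub) (leq_trans (dimv_add_leqif _ _).1 _).
by rewrite leq_add2l le_card.
Qed.

Lemma dim_row_span m n (A : 'M[K]_(m, n)) d :
  row_free A -> (d <= m)%N -> \dim (row_span A d) = d.
Proof.
move=> freeA le_dm; rewrite (dim_span_rows (fun i : 'I_m => (i < d)%N) freeA).
by rewrite -sum1_card (big_ord_narrow le_dm) sum1_card card_ord.
Qed.

Lemma row_spanMr m p n (A B : 'M[K]_(m, n)) (C : 'M_(n, p)) d e :
  (row_span A d <= row_span B e)%VS -> (row_span (A *m C) d <= row_span (B *m C) e)%VS.
Proof.
move/row_span_subP => sub; apply/row_span_subP => i /sub/row_spanP[c c0].
by rewrite row_mul => ->; rewrite -mulmxA; apply/row_spanP; exists c.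
Qed.

Lemma eq_row_spanMr m p n (A B : 'M[K]_(m, n)) (C : 'M_(n, p)) d :
  row_span A d = row_span B d -> row_span (A *m C) d = row_span (B *m C) d.
Proof.
by move=> eqAB; apply/eqP; rewrite eqEsubv !row_spanMr // eqAB.
Qed.

Lemma row_span_rowsub m n (A : 'M[K]_n) (le_mn : (m <= n)%N) d :
  (d <= m)%N -> row_span (rowsub (widen_ord le_mn) A) d = row_span A d.
Proof.
move=> le_dm; apply/eqP; rewrite eqEsubv; apply/andP; split; apply/row_span_subP => i lt_id.
  by rewrite row_rowsub; apply: mem_row_span.
pose i' := Ordinal (leq_trans lt_id le_dm).
have -> : i = widen_ord le_mn i' by apply: val_inj.
by rewrite -row_rowsub; apply: mem_row_span.
Qed.

End RowSpans.

(** * Reduced matrices *)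

Section ReducedMatrices.
Variables (K : fieldType) (n : nat).
Implicit Types (w : 'S_n) (T : 'M[K]_n).

(* The conditions defining M_w, imposed on all n rows. *)
Definition reduced w T : Prop :=
  [/\ forall i, T i (w i) = 1,
      forall i l : 'I_n, (w i < l)%N -> T i l = 0 &
      forall i k : 'I_n, (k < i)%N -> T i (w k) = 0].

(** T is triangular once its rows are ordered by pivot: in column w k, rows with a smaller pivot
    vanish, and those with a larger one already have coefficient 0. The disjunction lets some
    coefficients be known in advance and the others be read off from [c *m T]. *)
Lemma reduced_coef_eq0 w T j (c : 'rV[K]_n) : reduced w T ->
  (forall k, (j <= w k)%N -> c 0 k = 0 \/ (c *m T) 0 (w k) = 0) ->
  forall k, (j <= w k)%N -> c 0 k = 0.
Proof.
case=> T1 T0 _ hc.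
have step m : forall k, (n <= w k + m)%N -> (j <= w k)%N -> c 0 k = 0.
  elim: m => [|m IH] k; first by rewrite addn0 leqNgt ltn_ord.
  move=> le_n le_j; case: (hc k le_j) => //; rewrite mxE (bigD1 k) //= T1 mulr1.
  rewrite big1 ?addr0 // => i neq_ik.
  case: (ltngtP (w i) (w k)) => [lt|gt|eq].
  - by rewrite T0 ?mulr0.
  - by rewrite IH ?mul0r //; lia.
  - by case/eqP: neq_ik; apply/(@perm_inj _ w)/val_inj.
by move=> k; apply: (step n); rewrite leq_addl.
Qed.

Lemma reduced_unit w T : reduced w T -> T \in unitmx.
Proof.
move=> redT; rewrite -row_free_unit; apply: inj_row_free => c cT0.
apply/rowP => k; rewrite [RHS]mxE.
by apply: (@reduced_coef_eq0 w T 0%N c redT) => // k' _; right; rewrite cT0 mxE.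
Qed.

(** After cancelling Phi, a combination of rows of T vanishing from column j on involves only pivots
    below j, so the intersection is spanned by the rows k < d with w k < j. *)
Lemma dim_cap_reduced w T (Phi : 'M[K]_n) d j : reduced w T -> Phi \in unitmx ->
  \dim (row_span (T *m Phi) d :&: row_span Phi j)
    = #|[pred k : 'I_n | (k < d)%N && (w k < j)%N]|.
Proof.
move=> redT unitPhi; have [T1 T0 _] := redT.
pose S := [pred k : 'I_n | (k < d)%N && (w k < j)%N].
rewrite -(@dim_span_rows _ _ _ S (T *m Phi)); last first.
  by rewrite row_free_unit unitmx_mul (reduced_unit redT).
congr (\dim _); apply/eqP; rewrite eqEsubv; apply/andP; split; last first.
  apply/span_rows_subP => k /andP[lt_kd lt_wj]; rewrite memv_cap mem_row_span //=.
  rewrite row_mul; apply/row_spanP; exists (row k T) => // l le_jl.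
  by rewrite mxE T0 //; apply: leq_trans le_jl.
apply/subvP => v; rewrite memv_cap => /andP[/row_spanP[c c0 ->] /row_spanP[b b0]].
rewrite mulmxA => eq_cb.
have cT : c *m T = b by apply: (row_free_inj _ eq_cb); rewrite row_free_unit.
have cw0 := @reduced_coef_eq0 w T j c redT _.
rewrite -mulmxA; apply/span_rowsP; exists c => // k; rewrite negb_and -!leqNgt.
case/orP=> [|le_jw]; first exact: c0.
by apply: cw0 le_jw => k' le_jw'; right; rewrite cT b0.
Qed.

(** The difference of the two rows is a combination of the first d rows of T and vanishes at all
    their pivots: before i by reduction, at i because both entries are 1, after i because these
    pivots lie to the right of w i. *)
Lemma reduced_row_inj w T T' d (i : 'I_n) : reduced w T -> reduced w T' ->
  (i < d)%N -> (forall k : 'I_n, (i < k)%N -> (k < d)%N -> (w i < w k)%N) ->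
  row_span T d = row_span T' d -> row i T = row i T'.
Proof.
move=> redT redT' lt_id w_incr eqTT'; apply/eqP; rewrite -subr_eq0; apply/eqP.
have [T1 T0 Tr] := redT; have [T1' T0' Tr'] := redT'.
have : row i T - row i T' \in row_span T d.
  by rewrite memvB ?mem_row_span // eqTT' mem_row_span.
case/row_spanP=> c c0 def_y; rewrite def_y.
suff -> : c = 0 by rewrite mul0mx.
apply/rowP => k; rewrite [RHS]mxE.
apply: (@reduced_coef_eq0 w T 0%N c redT) => // {}k _; rewrite -def_y !mxE.
case: (leqP d k) => [/c0 ->|lt_kd]; first by left.
right; case: (ltngtP k i) => [lt_ki|lt_ik|/val_inj ->].
- by rewrite Tr ?Tr' // subr0.
- by rewrite T0 ?T0' ?subr0 ?w_incr.
- by rewrite T1 T1' subrr.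
Qed.

(* Row i is a nonzero vector of [W i] vanishing at the earlier pivots whose     *)
(* last nonzero entry is leftmost.  Minimality makes the pivots increase as     *)
(* long as W does not grow.                                                     *)
Lemma exists_reduced (W : 'I_n -> {vspace 'rV[K]_n}) :
  (forall i : 'I_n, (i < \dim (W i))%N) ->
  exists w T, [/\ reduced w T, forall i, row i T \in W i &
    forall i j : 'I_n, j = i.+1 :> nat -> W i = W j -> (w i < w j)%N].
Proof.
move=> dimW.
pose cand (p : 'I_n -> 'I_n) (i : 'I_n) (x : 'rV[K]_n) :=
  x \in W i /\ forall k : 'I_n, (k < i)%N -> x 0 (p k) = 0.
(* The earlier pivots impose i linear conditions on [W i], whose dimension exceeds i. *)
have nonzero_cand p i : exists2 x, x != 0 & cand p i x.
  pose g (k : 'I_i) := p (widen_ord (ltnW (ltn_ord i)) k).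
  pose f := linfun (mulmxr (colsub g 1%:M) : 'rV[K]_n -> 'rV[K]_i).
  have fE x k : f x 0 k = x 0 (g k) by rewrite lfunE /= mulmx_colsub mulmx1 mxE.
  have : (0 < \dim (W i :&: lker f))%N.
    have dimf : (\dim (f @: W i) <= i)%N.
      by apply: leq_trans (dimvS (subvf _)) _; rewrite dimvf dim_matrix; apply/eq_leq/mul1n.
    have := limg_ker_dim f (W i); case: posnP => // ->; rewrite add0n => eq_dim.
    by have := dimW i; rewrite -eq_dim ltnNge dimf.
  rewrite lt0n dimv_eq0 -vpick0 => nz; exists (vpick (W i :&: lker f)) => //.
  have := memv_pick (W i :&: lker f); rewrite memv_cap memv_ker => /andP[xW /eqP fx0].
  split=> // k lt_ki; have := fE (vpick (W i :&: lker f)) (Ordinal lt_ki).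
  by rewrite fx0 mxE => ->; congr (_ 0 (p _)); apply: val_inj.
pose lead (x : 'rV[K]_n) (j : 'I_n) := x 0 j != 0 /\ forall l : 'I_n, (j < l)%N -> x 0 l = 0.
have leadP x : x != 0 -> exists j, lead x j.
  case/rV0Pn=> j0 nz0; case: (@arg_maxnP _ j0 (fun j => x 0 j != 0) val nz0) => j nzj maxj.
  exists j; split=> // l lt_jl; apply/eqP; apply: contraTT lt_jl => /maxj.
  by rewrite -leqNgt.
have minimal p i : exists x j, [/\ cand p i x, x 0 j = 1, lead x j &
    forall y l, cand p i y -> lead y l -> (j <= l)%N].
  have [x0 nzx0 cx0] := nonzero_cand p i; have [j0 lx0] := leadP x0 nzx0.
  pose P j := `[< exists2 x, cand p i x & lead x j >].
  have P0 : P j0 by apply/asboolP; exists x0.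
  case: (@arg_minnP _ j0 P val P0) => j /asboolP[x [xW xp] [nzj xj]] minj.
  exists ((x 0 j)^-1 *: x), j; split; last by move=> y l cy ly; apply/minj/asboolP; exists y.
  - by split=> [|k lt_ki]; [rewrite memvZ | rewrite mxE xp ?mulr0].
  - by rewrite mxE mulVf.
  - by split=> [|l lt_jl]; rewrite mxE; [rewrite mulVf ?oner_eq0 | rewrite (xj l) ?mulr0].
have [p [x pxP]] : exists p x, forall i : 'I_n, [/\ cand p i (x i), x i 0 (p i) = 1,
    lead (x i) (p i) & forall y l, cand p i y -> lead y l -> (p i <= l)%N].
  (* Candidates for row i involve only the pivots before i, so choosing row m leaves the earlier
     choices minimal. *)
  suff build m : exists p x, forall i : 'I_n, (i < m)%N -> [/\ cand p i (x i), x i 0 (p i) = 1,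
    lead (x i) (p i) & forall y l, cand p i y -> lead y l -> (p i <= l)%N].
    by have [p [x h]] := build n; exists p, x => i; apply: h.
  elim: m => [|m [p [x IH]]]; first by exists id, (fun=> 0).
  case: (ltnP m n) => [lt_mn|le_nm]; last by exists p, x => i _; apply/IH/(leq_trans _ le_nm).
  have [y [j [cy yj ly minj]]] := minimal p (Ordinal lt_mn).
  pose upd (A : Type) (f : 'I_n -> A) z (i : 'I_n) := if i == Ordinal lt_mn then z else f i.
  have updN A (f : 'I_n -> A) z (i : 'I_n) : (i < m)%N -> @upd A f z i = f i.
    by rewrite /upd; case: eqP => // ->; rewrite ltnn.
  have candE (i : 'I_n) z : (i <= m)%N -> cand (@upd _ p j) i z <-> cand p i z.
    move=> le_im; split=> -[zW zp]; split=> // k lt_ki; have := zp k lt_ki;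
    by rewrite updN //; apply: leq_trans le_im.
  exists (@upd _ p j), (@upd _ x y) => i; rewrite ltnS leq_eqVlt => /orP[/eqP eq_im|lt_im].
    have -> : i = Ordinal lt_mn by apply: val_inj.
    rewrite /upd eqxx; split=> //; first exact/candE.
    by move=> z l /candE cz; apply: minj; apply: cz.
  have [ci xi li mini] := IH i lt_im; rewrite !updN //; split=> //; first exact/candE/ci/ltnW.
  by move=> z l /candE cz; apply: mini; apply/cz/ltnW.
have p_inj : injective p.
  move=> i k; wlog lt_ik : i k / (i < k)%N => [hw eq_p|eq_p].
    by case: (ltngtP i k) => [/hw|/hw/(_ (esym eq_p))|/val_inj //] => [/(_ eq_p)|].
  have [[_ xk] x1 _ _] := pxP k; move: x1; rewrite -eq_p xk // => /eqP.
  by rewrite eq_sym oner_eq0.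
exists (perm p_inj), (\matrix_i x i); split.
- split=> [i|i l|i k lt_ki]; rewrite mxE permE; have [[_ xk] x1 [_ x0] _] := pxP i => //.
    exact: x0.
  exact: xk.
- by move=> i; rewrite rowK; have [[]] := pxP i.
move=> i j eq_j eqW; rewrite !permE ltn_neqAle; apply/andP; split.
  by apply/negP => /eqP/val_inj/p_inj eq_ij; move: eq_j; rewrite eq_ij; lia.
(* Row j is itself a candidate for row i. *)
have [_ _ _ mini] := pxP i; have [[xW xp] _ lj _] := pxP j.
apply: mini lj; split=> [|k lt_ki]; first by rewrite eqW.
by apply: xp; rewrite eq_j ltnS ltnW.
Qed.

End ReducedMatrices.

(** * Rank functions and lengths of permutations *)

Section Combinatorics.
Local Open Scope nat_scope.

Section Permutations.
Variable n : nat.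
Implicit Types (u v w : 'S_n).

Lemma card_ord_lt d : d <= n -> #|[pred i : 'I_n | i < d]| = d.
Proof. by move=> le_dn; rewrite -sum1_card (big_ord_narrow le_dn) sum1_card card_ord. Qed.

Definition rk w p q := #|[pred k : 'I_n | (k < p) && (w k < q)]|.

Lemma rk0 w q : rk w 0 q = 0.
Proof. by apply: eq_card0 => k; rewrite !inE. Qed.

Lemma rkS w (p : 'I_n) q : rk w p.+1 q = (w p < q) + rk w p q.
Proof.
rewrite /rk (cardD1 p) !inE ltnSn; congr (_ + _); apply: eq_card => k; rewrite !inE.
by rewrite ltnS leq_eqVlt -val_eqE /=; case: ltngtP.
Qed.

Lemma rk_full v w p q : n <= p -> rk v p q = rk w p q.
Proof.
move=> le_np; have E u : rk u p q = #|[pred k : 'I_n | k < q]|.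
  rewrite /rk -!sum1_card [RHS](reindex_inj (@perm_inj _ u)).
  by apply: eq_bigl => k; rewrite !inE (leq_trans (ltn_ord k)).
by rewrite !E.
Qed.

Lemma in_Wa_lt a w (i k : 'I_n) : in_Wa a w -> i < k ->
  (forall d, d \in a -> i < d -> d <= k -> False) -> w i < w k.
Proof.
move=> Waw lt_ik nsep.
have step m (k' : 'I_n) : k' = i.+1 + m :> nat -> k' <= k -> w i < w k'.
  elim: m k' => [|m IH] k' def_k' le_k'.
    apply: Waw; rewrite ?def_k' ?addn0 //; apply/negP => /nsep; lia.
  have lt_k : i.+1 + m < n by move: (ltn_ord k); lia.
  apply: ltn_trans (IH (Ordinal lt_k) erefl _) _ => /=; first lia.
  by apply: Waw; rewrite ?def_k' ?addnS //; apply/negP => /nsep; lia.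
by apply: (step (k - i.+1)); lia.
Qed.

(* As a function of p, [rk v p q] is concave away from the dimensions in a, so  *)
(* a failure of the inequality at p would propagate to the left or to the right *)
(* until it reaches an element of a, or 0, or n.                                *)
Lemma rk_le_of_Wa a v w : in_Wa a v ->
  (forall d q, d \in a -> rk w d q <= rk v d q) ->
  forall p q, p <= n -> rk w p q <= rk v p q.
Proof.
move=> Wav le_a p q le_pn.
have left m : forall x : 'I_n, x = m :> nat -> v x < q -> rk w x.+1 q <= rk v x.+1 q.
  elim: m => [|m IH] x def_x lt_vq; rewrite !rkS lt_vq {1 2}def_x ?rk0 ?addn0 ?leq_b1 //.
  apply: leq_add (leq_b1 _) _; rewrite -def_x.
  have [|notin] := boolP (nat_of_ord x \in a); first by move/le_a; rewrite def_x.
  have lt_m : m < n by move: (ltn_ord x); lia.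
  rewrite def_x; apply: (IH (Ordinal lt_m)) => //.
  by apply: ltn_trans lt_vq; apply: Wav.
have right m : forall x : 'I_n, n = m.+1 + x -> q <= v x -> rk w x q <= rk v x q.
  elim: m => [|m IH] x def_x le_qv.
    have := @rk_full v w x.+1 q (eq_leq def_x); rewrite !rkS ltnNge le_qv add0n => ->.
    exact: leq_addl.
  have lt_x : x.+1 < n by lia.
  suff : rk w x.+1 q <= rk v x.+1 q.
    by rewrite !rkS [v x < q]ltnNge le_qv; apply: leq_trans (leq_addl _ _).
  have [/le_a //|notin] := boolP (x.+1 \in a).
  apply: (IH (Ordinal lt_x)) => /=; first lia.
  by apply: leq_trans le_qv (ltnW _); apply: Wav.
case: p le_pn => [|p] lt_pn; first by rewrite !rk0.
case: (ltnP (v (Ordinal lt_pn)) q) => [|le_qv]; first exact: (left p).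
have [/le_a //|notin] := boolP (p.+1 \in a).
have [lt_Spn|le_nSp] := ltnP p.+1 n; last by rewrite (rk_full v w).
apply: (right (n - p.+2) (Ordinal lt_Spn)) => /=; first lia.
by apply: leq_trans le_qv (ltnW _); apply: Wav.
Qed.

(** Inversions of v inject into those of the product: t moves a pair whose order it keeps, and a
    pair whose order it reverses remains an inversion because v i < v k. The inversion (i, k) is not
    reached. *)
Lemma perm_length_tperm v (i k : 'I_n) : i < k -> v i < v k ->
  perm_length v < perm_length (tperm i k * v)%g.
Proof.
move=> lt_ik lt_v; pose t := tperm i k.
pose f (p : 'I_n * 'I_n) := if t p.1 < t p.2 then (t p.1, t p.2) else p.
pose S : {set 'I_n * 'I_n} := [set p : 'I_n * 'I_n | (p.1 < p.2) && (v p.2 < v p.1)].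
have f_inj : {in S &, injective f}.
  case=> [x y] [x' y']; rewrite /f /= !inE /= => /andP[lt_xy _] /andP[lt_xy' _].
  case: ifP => lt1; case: ifP => lt2 //; case.
  - by move=> /perm_inj -> /perm_inj ->.
  - by move=> eq_x eq_y; move: lt2; rewrite -eq_x -eq_y !tpermK lt_xy.
  - by move=> eq_x eq_y; move: lt1; rewrite eq_x eq_y !tpermK lt_xy'.
rewrite /perm_length -(card_in_imset f_inj); apply: proper_card.
apply/fintype.properP; split.
  apply/fintype.subsetP => _ /imsetP[[x y] + ->]; rewrite /f !inE /= => /andP[lt_xy lt_vyx].
  case: ifP => [lt_t|/negbT]; rewrite /= !permM; first by rewrite !tpermK lt_t.
  rewrite -leqNgt lt_xy /= /t.
  case: (tpermP i k x) => [ex|ex|_ _]; case: (tpermP i k y) => [ey|ey|_ _];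
    move: lt_xy lt_vyx lt_ik lt_v; rewrite ?ex ?ey; lia.
exists (i, k); first by rewrite inE /= lt_ik !permM tpermL tpermR.
apply/imsetP => -[[x y]]; rewrite inE /f /= => /andP[lt_xy lt_v'].
case: ifP => [lt_t [ei ek]|_ [ei ek]]; last by move: lt_v'; rewrite -ei -ek; lia.
have ex : x = k by rewrite -(tpermK i k x) -/t -ei /t tpermL.
have ey : y = i by rewrite -(tpermK i k y) -/t -ek /t tpermR.
by move: lt_xy; rewrite ex ey; lia.
Qed.

(** One step up in Bruhat order: i is the first position where v and w differ, and v i is swapped
    with the first later value in the interval from v i + 1 to w i. *)
Lemma rk_step v w : v != w -> (forall p q, p <= n -> rk w p q <= rk v p q) ->
  exists v', (forall p q, p <= n -> rk w p q <= rk v' p q) /\ perm_length v < perm_length v'.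
Proof.
move=> neq_vw le_rk.
have [i0 neq0] : exists i, v i != w i.
  by apply/existsP; apply: contraNT neq_vw => /existsPn eq_vw; apply/eqP/permP => i;
    apply/eqP/negbNE.
case: (@arg_minnP _ i0 (fun i => v i != w i) val neq0) => /= i neq_i min_i.
have eq_lt (x : 'I_n) : x < i -> v x = w x.
  by move=> lt_xi; apply/eqP; apply: contraTT lt_xi => /min_i; rewrite -leqNgt.
(* Otherwise domination fails at [(i.+1, (w i).+1)], since v and w agree before i. *)
have lt_i : v i < w i.
  rewrite ltn_neqAle neq_i leqNgt; apply/negP => lt_wv.
  have := le_rk i.+1 (w i).+1 (ltn_ord i);
    rewrite !rkS ltnSn [v i < _]ltnS [v i <= _]leqNgt lt_wv /=.
  suff -> : rk v i (w i).+1 = rk w i (w i).+1 by lia.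
  by apply: eq_card => x; rewrite !inE; case: ltnP => //= /eq_lt ->.
pose P (k : 'I_n) := (i < k) && (v i < v k <= w i).
have P0 : P ((v^-1)%g (w i)).
  rewrite /P permKV lt_i leqnn !andbT.
  case: ltngtP => // [/eq_lt|/val_inj eq_i]; rewrite ?permKV.
    by move/perm_inj => eq_i; move: lt_i; rewrite {1}eq_i permKV ltnn.
  by move: lt_i; rewrite {1}eq_i permKV ltnn.
case: (@arg_minnP _ _ P val P0) => /= k /and3P[lt_ik lt_vik le_vkw] min_k.
exists (tperm i k * v)%g; split; last exact: perm_length_tperm.
move=> p q le_pn.
pose rest u := #|[predD1 [predD1 [pred x : 'I_n | (x < p) && (u x < q)] & i] & k]|.
have neq_ik : k != i by rewrite -val_eqE /= gtn_eqF.
have rkE (u : 'S_n) : rk u p q = ((i < p) && (u i < q)) + (((k < p) && (u k < q)) + rest u).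
  by rewrite /rk (cardD1 i) (cardD1 k) !inE neq_ik.
have rest_eq : rest (tperm i k * v)%g = rest v.
  apply: eq_card => x; rewrite !inE permM.
  by case: tpermP => [->|->|//]; rewrite eqxx // andbF.
have := le_rk p q le_pn; rewrite (rkE v) (rkE (_ * v)%g) rest_eq !permM tpermL tpermR.
(* The swap lowers the rank, by one, exactly on this rectangle; there strict domination of w by v is
   required. *)
case: (boolP [&& i < p, p <= k, v i < q & q <= v k]) => [/and4P[lt_ip le_pk lt_viq le_qvk]|];
  last first.
  by move: (rest v) (rk w p q); lia.
(* [cnt] counts values from q to w i before p. By minimality of k, those of v sit at positions
   before i, where v and w agree, and w has one more at i. Domination at height [(w i).+1] is
   therefore strict at height q. *)
move=> _; pose cnt u := #|[pred x : 'I_n | [&& x < p, q <= u x & u x < (w i).+1]]|.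
have cntE (u : 'S_n) : rk u p (w i).+1 = rk u p q + cnt u.
  rewrite /rk -(cardID [pred x : 'I_n | u x < q]); congr (_ + _); apply: eq_card => x;
    rewrite !inE -?leqNgt; case: (x < p); rewrite ?andbF //=.
  by rewrite andb_idl // => /leq_trans; apply; rewrite leqW // (leq_trans le_qvk).
have : cnt v < cnt w.
  apply/proper_card/fintype.properP; split; last first.
    exists i; first by rewrite !inE lt_ip ltnSn (leq_trans le_qvk).
    by rewrite !inE lt_ip [q <= v i]leqNgt lt_viq.
  apply/fintype.subsetP => x; rewrite !inE => /and3P[lt_xp le_qx lt_x].
  case: (ltngtP x i) => [lt_xi|lt_ix|/val_inj eq_x].
  - by rewrite -eq_lt // lt_xp le_qx.
  - have Px : P x by rewrite /P lt_ix -[v x <= w i]ltnS lt_x andbT (leq_trans lt_viq).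
    by have := min_k x Px; rewrite leqNgt (leq_trans lt_xp).
  - by move: le_qx; rewrite eq_x [q <= v i]leqNgt lt_viq.
have := le_rk p (w i).+1 le_pn; rewrite !cntE (rkE v).
move: (rest v) (rk w p q) (cnt v) (cnt w); lia.
Qed.

(** Iterates [rk_step], which must reach w because lengths are at most n * n. *)
Lemma rk_le_perm_length v w : (forall p q, p <= n -> rk w p q <= rk v p q) ->
  v = w \/ perm_length v < perm_length w.
Proof.
have bound u : perm_length u <= n * n.
  by apply: leq_trans (max_card _) _; rewrite card_prod card_ord.
have [m] := ubnP (n * n - perm_length v); elim: m v => // m IH v lt_m le_rk.
have [->|neq_vw] := eqVneq v w; first by left.
right; have [v' [le_rk' lt_v']] := rk_step neq_vw le_rk.
have [|<- //|/(ltn_trans lt_v') //] := IH v' _ le_rk'.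
by move: (bound v') lt_m lt_v'; lia.
Qed.

Lemma rk_inj v w : (forall p q, p <= n -> rk v p q = rk w p q) -> v = w.
Proof.
move=> eq_rk.
have [//|lt_vw] := @rk_le_perm_length v w (fun p q le_pn => eq_leq (esym (eq_rk p q le_pn))).
have [//|] := @rk_le_perm_length w v (fun p q le_pn => eq_leq (eq_rk p q le_pn)).
by rewrite ltnNge ltnW.
Qed.

Lemma w0_conjE w i : (w0 n * w * w0 n)%g i = rev_ord (w (rev_ord i)).
Proof. by rewrite !permM !permE. Qed.

Lemma perm_length_dual w : perm_length (w0 n * w * w0 n)%g = perm_length w.
Proof.
pose f (p : 'I_n * 'I_n) := (rev_ord p.2, rev_ord p.1).
have f_inj : injective f by apply: (@inv_inj _ f) => -[x y]; rewrite /f /= !rev_ordK.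
rewrite /perm_length -[RHS](card_preimset _ f_inj); apply: eq_card => -[x y].
rewrite !inE /= !w0_conjE /=.
by move: (ltn_ord x) (ltn_ord y) (ltn_ord (w (rev_ord x))) (ltn_ord (w (rev_ord y))); lia.
Qed.

End Permutations.

(** The positions strictly above the diagonal blocks cut out by a. They index the tangent directions
    of the flag manifold, the equations, and, for w in W^a, include all inversions. *)
Definition separated (a : seq nat) i k := has (fun d => (i < d) && (d <= k)) a.

Lemma separatedP a i k : reflect (exists d, [/\ d \in a, i < d & d <= k]) (separated a i k).
Proof.
apply: (iffP hasP) => [[d da /andP[? ?]]|[d [da ? ?]]]; exists d => //.
by apply/andP.
Qed.

Lemma flag_path_bound n b a d : path ltn b (rcons a n) -> d \in a -> b < d < n.
Proof.
elim: a b => //= c a IH b /andP[lt_bc path_a]; rewrite in_cons.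
case/predU1P=> [->|/(IH c path_a)/andP[lt_cd ->]]; last by rewrite (ltn_trans lt_bc).
have /allP/(_ n) := order_path_min ltn_trans path_a.
by rewrite lt_bc mem_rcons in_cons eqxx => ->.
Qed.

Lemma flag_path_last n b a d : path ltn b (rcons a n) -> d \in b :: a -> d <= last b a.
Proof.
elim: a b d => [|c a IH] b d /=; first by rewrite mem_seq1 => _ /eqP ->.
move=> /andP[lt_bc path_a]; rewrite in_cons => /predU1P[->|]; last exact: IH.
by apply: leq_trans (ltnW lt_bc) (IH c c path_a _); rewrite mem_head.
Qed.

Lemma card_ord_interval n b d : d <= n -> #|[pred i : 'I_n | b <= i < d]| = d - b.
Proof.
move=> le_dn; have [le_bd|lt_db] := leqP b d; last first.
  by rewrite (eqP (ltnW lt_db)); apply: eq_card0 => i; rewrite !inE; lia.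
suff : #|[pred i : 'I_n | b <= i < d]| + b = d by lia.
rewrite -[RHS](card_ord_lt le_dn) -[X in _ + X](card_ord_lt (leq_trans le_bd le_dn)) addnC.
rewrite -[RHS](cardID [pred i : 'I_n | i < b]).
by congr (_ + _); apply: eq_card => i; rewrite !inE; lia.
Qed.

(** The start is generalized from 0 to b for the induction on a: for b <= i < d, with d the head,
    separation means d <= k, which gives a rectangle. *)
Lemma card_separated_from n b a : path ltn b (rcons a n) ->
  #|[set p : 'I_n * 'I_n | (b <= p.1) && separated a p.1 p.2]| =
  \sum_(m < size a) (nth 0 a m - nth 0 (b :: a) m) * (n - nth 0 a m).
Proof.
elim: a b => [|d a IH] b path_a.
  by rewrite big_ord0; apply: eq_card0 => p; rewrite !inE andbF.
have /andP[lt_bd path_da] : (b < d) && path ltn d (rcons a n) by [].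
have /andP[_ lt_dn] : b < d < n by apply: flag_path_bound path_a _; rewrite mem_head.
rewrite big_ord_recl /= -(IH d path_da).
pose S : {set 'I_n} := [set i : 'I_n | b <= i < d].
pose T : {set 'I_n} := [set k : 'I_n | d <= k < n].
have -> : (d - b) * (n - d) = #|finset.setX S T|.
  by rewrite cardsX !cardsE !card_ord_interval // ltnW.
rewrite -cardsUI [X in _ + X](_ : _ = 0) ?addn0; last first.
  by apply: eq_card0 => p; rewrite !inE [p.1 < d]ltnNge; case: (d <= p.1); rewrite ?andbF.
apply: eq_card => p; rewrite !inE ltn_ord /= andbT /separated /=.
have [lt_pd|le_dp] := ltnP p.1 d; last first.
  by rewrite andbF /= (leq_trans (ltnW lt_bd) le_dp).
rewrite orbF /= andbT; case: (b <= p.1) => //=; apply/orb_idr.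
case/hasP=> e ea /andP[_ le_ep]; apply: leq_trans le_ep.
by have /andP[/ltnW] := flag_path_bound path_da ea.
Qed.

(** * Dimension sequences, their duals, and the counts of free entries and equations *)

Section FlagDims.
Variables (n : nat) (a : seq nat).
Hypothesis flag_a : flag_dims n a.
Implicit Types (w : 'S_n).

Lemma flag_dims_bound d : d \in a -> 0 < d < n.
Proof. by case/andP: flag_a => _; apply: flag_path_bound. Qed.

Lemma flag_dims_last d : d \in a -> d <= last 0 a.
Proof. by case/andP: flag_a => _ path_a da; apply: (flag_path_last path_a);
  rewrite in_cons da orbT. Qed.

Lemma flag_last_le : last 0 a <= n.
Proof.
have : last 0 a \in a by case: a flag_a => //= d s _; apply: mem_last.
by case/flag_dims_bound/andP=> _ /ltnW.
Qed.

Lemma card_separated : #|[set p : 'I_n * 'I_n | separated a p.1 p.2]| = dim_flags n a.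
Proof. by case/andP: flag_a => _ path_a; rewrite /dim_flags -(card_separated_from path_a). Qed.

Lemma in_Wa_inversion w (i k : 'I_n) : in_Wa a w -> i < k -> w k < w i -> separated a i k.
Proof.
move=> Waw lt_ik; apply: contraLR => nsep; rewrite -leqNgt ltnW //.
by apply: (in_Wa_lt Waw) => // d da lt_id le_dk; case/separatedP: nsep; exists d.
Qed.

Lemma perm_length_le_dim w : in_Wa a w -> perm_length w <= dim_flags n a.
Proof.
move=> Waw; rewrite -card_separated; apply: subset_leq_card.
by apply/fintype.subsetP => p; rewrite !inE => /andP[]; apply: in_Wa_inversion.
Qed.

Lemma mem_dual_dims d : d \in a -> n - d \in dual_dims n a.
Proof. by move=> da; rewrite mem_rev; apply: map_f. Qed.

Lemma dual_dimsP e : e \in dual_dims n a -> exists2 d, d \in a & e = n - d.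
Proof. by rewrite mem_rev => /mapP. Qed.

Lemma flag_dual_dims : flag_dims n (dual_dims n a).
Proof.
case/andP: flag_a => a_nil path_a; apply/andP; split.
  by rewrite -size_eq0 size_rev size_map size_eq0.
(* Complementation exchanges the end points 0 and n, so the extended list is reversed as a whole. *)
pose s := 0 :: rcons a n.
have -> : path ltn 0 (rcons (dual_dims n a) n) = sorted ltn (rev [seq n - d | d <- s]).
  by rewrite /= map_rcons rev_cons rev_rcons subnn subn0.
rewrite rev_sorted; apply: (homo_sorted_in (P := fun d => d <= n) (e := ltn)) => //=.
  by move=> x y xn yn lt_xy; move: (xn : x <= n) (yn : y <= n) (lt_xy : x < y); lia.
by rewrite all_rcons leqnn; apply/allP => d /flag_dims_bound/andP[_ /ltnW].
Qed.

Lemma dual_last_ge d : d \in a -> n - d <= last 0 (dual_dims n a).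
Proof.
case/andP: flag_dual_dims => _ path_a' /mem_dual_dims da.
by apply: (flag_path_last path_a'); rewrite in_cons da orbT.
Qed.

Lemma in_Wa_dual w : in_Wa a w -> in_Wa (dual_dims n a) (w0 n * w * w0 n)%g.
Proof.
move=> Waw i j def_j notin; rewrite !w0_conjE /=.
suff : w (rev_ord j) < w (rev_ord i) by move: (ltn_ord (w (rev_ord i))); lia.
apply: Waw => /=; first by move: (ltn_ord j); lia.
apply: contra notin => /mem_dual_dims; rewrite (_ : n - _ = j) //=.
by move: (ltn_ord i); lia.
Qed.

Lemma perm_natE w (i : 'I_(last 0 a)) :
  perm_nat w i = w (widen_ord flag_last_le i).
Proof.
rewrite /perm_nat; case: insubP => [k _ eq_ki|];
  last by rewrite (leq_trans (ltn_ord i)) // flag_last_le.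
by congr (nat_of_ord (w _)); apply: val_inj.
Qed.

Lemma is_oneE w (i : 'I_(last 0 a)) (j : 'I_n) :
  is_one a w i j = (j == w (widen_ord flag_last_le i)).
Proof. by rewrite /is_one perm_natE. Qed.

Lemma is_zeroP w (i : 'I_(last 0 a)) (j : 'I_n) : reflect
  (w (widen_ord flag_last_le i) < j \/ exists2 k : 'I_n, k < i & j = w k) (is_zero a w i j).
Proof.
rewrite /is_zero perm_natE; apply: (iffP orP) => -[lt|]; try by left.
  case/existsP=> k /andP[lt_ki /eqP]; rewrite perm_natE => /val_inj ->.
  by right; exists (widen_ord flag_last_le k).
case=> k lt_ki ->; right; apply/existsP; exists (Ordinal (ltn_trans lt_ki (ltn_ord i))).
by rewrite lt_ki perm_natE /=; apply/eqP; congr (nat_of_ord (w _)); apply: val_inj.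
Qed.

Lemma is_freeE w (i : 'I_(last 0 a)) (j : 'I_n) (i' := widen_ord flag_last_le i) :
  is_free a w i j = (i' < (w^-1)%g j) && (j < w i').
Proof.
rewrite /is_free is_oneE; apply/andP/andP => [[neq_j nzero]|[lt_i lt_j]].
  have lt_j : j < w i'.
    rewrite ltn_neqAle neq_j leqNgt; apply: contra nzero => lt_wj.
    by apply/is_zeroP; left.
  split=> //; case: ltngtP => // [lt_wi|/val_inj eq_i].
    by case/is_zeroP: nzero; right; exists ((w^-1)%g j); rewrite ?permKV.
  by move: lt_j; rewrite eq_i permKV ltnn.
split; first by rewrite neq_ltn lt_j.
apply/is_zeroP => -[|[k lt_ki def_j]]; first by rewrite ltnNge ltnW.
by move: lt_i; rewrite def_j permK /= ltnNge ltnW.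
Qed.

(** The free entry (i, j) corresponds to the inversion (i, w^-1 j). The first a_t rows see every
    inversion, since each one is separated by an element of a. *)
Lemma card_free w : in_Wa a w ->
  #|[set p : 'I_(last 0 a) * 'I_n | is_free a w p.1 p.2]| = perm_length w.
Proof.
move=> Waw; pose f (p : 'I_(last 0 a) * 'I_n) := (widen_ord flag_last_le p.1, (w^-1)%g p.2).
have f_inj : injective f.
  by case=> [i j] [i' j'] [] /val_inj/= -> /perm_inj ->.
rewrite -(card_imset _ f_inj); apply: eq_card => -[i k]; rewrite !inE /=.
apply/imsetP/andP => [[[i' j]]|[lt_ik lt_w]].
  by rewrite inE /= is_freeE => /andP[lt_i lt_j] [-> ->]; rewrite permKV.
have /separatedP[d [/flag_dims_last le_d lt_id _]] := in_Wa_inversion Waw lt_ik lt_w.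
exists (Ordinal (leq_trans lt_id le_d), w k); last first.
  by rewrite /f /= permK; congr pair; apply: val_inj.
rewrite inE /= is_freeE permK; set i' := widen_ord _ _.
by rewrite (_ : i' = i) ?lt_ik //; apply: val_inj.
Qed.

(** Reversing the second index turns j < n - d into d <= n - 1 - j, so equations correspond to
    separated pairs. *)
Lemma card_zero_index : #|zero_index n a| = dim_flags n a.
Proof.
have le_dual : last 0 (dual_dims n a) <= n.
  have : last 0 (dual_dims n a) \in dual_dims n a.
    by case: (dual_dims n a) flag_dual_dims => //= d s _; apply: mem_last.
  by case/dual_dimsP=> d _ ->; apply: leq_subr.
pose f (p : 'I_(last 0 a) * 'I_(last 0 (dual_dims n a))) :=
  (widen_ord flag_last_le p.1, rev_ord (widen_ord le_dual p.2)).
have f_inj : injective f.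
  move=> [i j] [i' j'] eq_f; congr pair; apply: val_inj.
    exact: (congr1 (fun p : 'I_n * 'I_n => val p.1) eq_f).
  by have := congr1 (fun p : 'I_n * 'I_n => val (rev_ord p.2)) eq_f; rewrite /f !rev_ordK.
rewrite -card_separated -(card_imset _ f_inj); apply: eq_card => -[i k]; rewrite !inE /=.
apply/imsetP/separatedP => [[[i' j]]|[d [da lt_id le_dk]]].
  rewrite inE /= => /hasP[d da /andP[lt_id lt_jd]] [-> ->]; exists d; split=> //=; lia.
have lt_j : n - k.+1 < n - d by move: (ltn_ord k); lia.
exists (Ordinal (leq_trans lt_id (flag_dims_last da)), Ordinal (leq_trans lt_j (dual_last_ge da))).
  by rewrite inE; apply/hasP; exists d => //=; rewrite lt_id lt_j.
rewrite /f; congr pair; apply: val_inj => //=.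
by move: (ltn_ord k); lia.
Qed.

End FlagDims.

End Combinatorics.

(** * Flags and Schubert cells *)

Section Flags.
Variables (K : fieldType) (n : nat) (a : seq nat).
Hypothesis flag_a : flag_dims n a.
Implicit Types (w v : 'S_n) (A B C T Phi : 'M[K]_n).

Definition top_rows A : 'M[K]_(last 0%N a, n) := rowsub (widen_ord (flag_last_le flag_a)) A.

Lemma R_flag_eqP m m' (A : 'M[K]_(m, n)) (B : 'M[K]_(m', n)) :
  R_flag a A = R_flag a B <-> forall d, d \in a -> row_span A d = row_span B d.
Proof.
split=> [eqAB d da|eqAB]; last by apply/funext => i; apply/eqAB/mem_nth.
have lt_d : (index d a < size a)%N by rewrite index_mem.
by have := congr1 (fun F => F (Ordinal lt_d)) eqAB; rewrite /R_flag /= nth_index.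
Qed.

Lemma R_flag_top_rows A Phi : R_flag a (top_rows A *m Phi) = R_flag a (A *m Phi).
Proof.
rewrite mul_rowsub_mx; apply/R_flag_eqP => d da.
by apply: row_span_rowsub; apply: flag_dims_last flag_a _ da.
Qed.

Lemma partial_flag_R_flag A : A \in unitmx -> partial_flag a (R_flag a A).
Proof.
move=> unitA; split=> [i|i j le_ij].
  have /andP[_ lt_d] := flag_dims_bound flag_a (mem_nth 0%N (ltn_ord i)).
  by rewrite dim_row_span ?row_free_unit // ltnW.
apply: row_spanS; have /andP[_ path_a] := flag_a.
have : sorted leq a.
  by move: path_a; rewrite rcons_path => /andP[/path_sorted + _]; apply: sub_sorted => x y /ltnW.
by move=> sorted_a; apply: (sorted_leq_nth leq_trans leqnn); rewrite ?inE.
Qed.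

Lemma exists_reduced_span (V : subspaces K (size a) n) : partial_flag a V ->
  exists v T, [/\ in_Wa a v, reduced v T & V = R_flag a T].
Proof.
move=> [dimV V_mono]; pose blk (i : 'I_n) := find (fun d => (i < d)%N) a.
(* [W i] is the first member of V of dimension above i, or the whole space if i >= a_t. It is
   constant on the blocks of a, where the pivots therefore increase. *)
pose W i := if insub (blk i) is Some m then V m else fullv.
have blk_le (i : 'I_n) (m : 'I_(size a)) : (i < nth 0 a m)%N -> (blk i <= m)%N.
  move=> lt_i; rewrite leqNgt; apply/negP => /(before_find 0%N).
  by rewrite lt_i.
have W_le (i : 'I_n) (m : 'I_(size a)) : (i < nth 0 a m)%N -> (W i <= V m)%VS.
  move=> /blk_le le_m; rewrite /W; case: insubP => [k _ eq_k|].
    by apply: V_mono; rewrite eq_k.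
  by rewrite (leq_ltn_trans le_m).
have dimW (i : 'I_n) : (i < \dim (W i))%N.
  rewrite /W; case: insubP => [m lt_m eq_m|_].
    by rewrite dimV -[nat_of_ord m]/(val m) eq_m; apply: (nth_find 0%N); rewrite has_find.
  by rewrite dimvf dim_matrix; apply: leq_trans (ltn_ord i) (eq_leq (esym (mul1n n))).
have [v [T [redT T_W v_incr]]] := exists_reduced dimW.
exists v, T; split=> //.
  move=> i j def_j notin; apply: v_incr => //; rewrite /W;
    congr (if insub _ is Some _ then _ else _).
  apply: eq_in_find => d da; have : d <> j by move=> eq_d; rewrite -eq_d da in notin.
  by rewrite def_j; lia.
apply/funext => m; apply/esym/eqP; rewrite eqEdim; apply/andP; split.
  by apply/row_span_subP => i lt_i; apply: (subvP (W_le i m lt_i)).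
rewrite dimV dim_row_span ?row_free_unit ?(reduced_unit redT) //.
by have /andP[_ /ltnW] := flag_dims_bound flag_a (mem_nth 0%N (ltn_ord m)).
Qed.

Lemma exists_reduced_flag Phi (V : subspaces K (size a) n) : Phi \in unitmx ->
  partial_flag a V -> exists v T, [/\ in_Wa a v, reduced v T & V = R_flag a (T *m Phi)].
Proof.
move=> unitPhi /exists_reduced_span[v0 [A [_ redA ->]]].
have /partial_flag_R_flag/exists_reduced_span[v [T [Wav redT eq_T]]] : A *m invmx Phi \in unitmx.
  by rewrite unitmx_mul (reduced_unit redA) unitmx_inv.
exists v, T; split=> //; apply/R_flag_eqP => d da.
rewrite -{1}(mulmxKV unitPhi A); apply: eq_row_spanMr.
exact: (R_flag_eqP _ _).1 eq_T d da.
Qed.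

Lemma dim_R_flag_cap v T Phi (m : 'I_(size a)) (j : 'I_n) :
  reduced v T -> Phi \in unitmx ->
  \dim (R_flag a (T *m Phi) m :&: R_complete Phi j) = rk v (nth 0 a m) j.+1.
Proof. exact: dim_cap_reduced. Qed.

(** Flag members only give 1 <= q <= n; for q = 0 the counts vanish, and beyond n they are those at
    n. The relation R serves both domination and equality. *)
Lemma rk_ext_flag (R : nat -> nat -> Prop) v w : R 0 0 ->
  (forall (m : 'I_(size a)) (j : 'I_n), R (rk v (nth 0 a m) j.+1) (rk w (nth 0 a m) j.+1)) ->
  forall d q, d \in a -> R (rk v d q) (rk w d q).
Proof.
move=> R0 Rvw d q da.
have lt_d : (index d a < size a)%N by rewrite index_mem.
have /andP[_ lt_dn] := flag_dims_bound flag_a da.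
have {}Rvw := Rvw (Ordinal lt_d); rewrite /= nth_index // in Rvw.
have rk_q0 u : rk u d 0 = 0%N by apply: eq_card0 => k; rewrite !inE andbF.
case: q => [|q]; first by rewrite !rk_q0.
case: (ltnP q n) => [lt_qn|le_nq]; first exact: Rvw (Ordinal lt_qn).
have n_gt0 : (n.-1 < n)%N by lia.
have rk_n (u : 'S_n) : rk u d q.+1 = rk u d n.-1.+1.
  apply: eq_card => k; rewrite !inE; congr (_ && _).
  by move: (ltn_ord (u k)); lia.
by rewrite !rk_n; apply: Rvw (Ordinal n_gt0).
Qed.

Lemma schubert_reduced_le v w T Phi : reduced v T -> Phi \in unitmx -> in_Wa a v ->
  schubert_variety a w (R_complete Phi) (R_flag a (T *m Phi)) ->
  v = w \/ (perm_length v < perm_length w)%N.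
Proof.
move=> redT unitPhi Wav [_ le_dim]; apply/rk_le_perm_length/(rk_le_of_Wa Wav).
move=> d q da; apply: (rk_ext_flag (R := fun x y => (y <= x)%N)) => // m j.
by rewrite -(dim_R_flag_cap _ _ redT unitPhi); apply: le_dim.
Qed.

Lemma rk_inj_Wa v w : in_Wa a v -> in_Wa a w ->
  (forall d q, d \in a -> rk v d q = rk w d q) -> v = w.
Proof.
move=> Wav Waw eq_rk; apply: rk_inj => p q le_pn; apply/eqP; rewrite eqn_leq.
by rewrite (rk_le_of_Wa Waw) ?(rk_le_of_Wa Wav) // => d {}q da; rewrite eq_rk.
Qed.

Lemma local_M_reduced w (M : 'M[K]_(last 0%N a, n)) :
  local_M a w M <-> exists2 T, reduced w T & M = top_rows T.
Proof.
split=> [locM|[T [T1 T0 Tr] ->] i j]; last first.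
  split; first by rewrite (is_oneE flag_a) mxE => /eqP ->.
  by case/(is_zeroP flag_a)=> [|[k lt_ki ->]]; rewrite mxE; [apply: T0 | apply: Tr].
(* The missing rows are taken from the permutation matrix of w. *)
pose T := \matrix_(i < n, j < n) if insub (i : nat) is Some k then M k j else (j == w i)%:R.
have M1 (k : 'I_(last 0 a)) (i : 'I_n) : k = i :> nat -> M k (w i) = 1.
  move=> eq_ki; apply: (locM k (w i)).1; rewrite (is_oneE flag_a).
  by apply/eqP; congr (w _); apply: val_inj.
have M0 (k : 'I_(last 0 a)) (i l : 'I_n) : k = i :> nat -> (w i < l)%N -> M k l = 0.
  move=> eq_ki lt_l; apply: (locM k l).2; apply/(is_zeroP flag_a); left.
  by rewrite (_ : widen_ord _ k = i) //; apply: val_inj.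
have Mr (k : 'I_(last 0 a)) (i l : 'I_n) : k = i :> nat -> (l < i)%N -> M k (w l) = 0.
  move=> eq_ki lt_li; apply: (locM k (w l)).2; apply/(is_zeroP flag_a); right.
  by exists l; rewrite ?eq_ki.
exists T; last first.
  apply/matrixP => k j; rewrite !mxE; case: insubP => [k' _ /val_inj -> //|].
  by rewrite /= ltn_ord.
split=> [i|i l lt_l|i k lt_k]; rewrite mxE; case: insubP => [k' _ eq_k|_].
- exact: M1.
- by rewrite eqxx.
- exact: M0 eq_k lt_l.
- by case: eqP lt_l => // ->; rewrite ltnn.
- exact: Mr eq_k lt_k.
- by rewrite (inj_eq perm_inj); case: eqP lt_k => // ->; rewrite ltnn.
Qed.

Lemma top_rows_inj w T T' A : in_Wa a w -> reduced w T -> reduced w T' ->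
  R_flag a T = R_flag a A -> R_flag a T' = R_flag a A -> top_rows T = top_rows T'.
Proof.
move=> Waw redT redT' /R_flag_eqP eqT /R_flag_eqP eqT'; apply/row_matrixP => i.
rewrite !row_rowsub; set i' := widen_ord _ i.
(* d ends the block of i, and w increases from i up to d. *)
have [] : exists d, [/\ d \in a, (i < d)%N & forall e, e \in a -> (i < e)%N -> (d <= e)%N].
  have last_a : last 0%N a \in a by case: (a) flag_a => //= d s _; apply: mem_last.
  have ex_d : exists d, (d \in a) && (i < d)%N by exists (last 0%N a); rewrite last_a ltn_ord.
  case: (ex_minnP ex_d) => d /andP[da lt_id] min_d; exists d; split=> // e ea lt_ie.
  by apply: min_d; rewrite ea.
move=> d [da lt_id min_d]; apply: (@reduced_row_inj _ _ w T T' d i' redT redT' lt_id).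
  move=> k lt_ik lt_kd; apply: (in_Wa_lt Waw) => // e ea /(min_d e ea) le_de le_ek.
  by move: lt_kd; rewrite ltnNge (leq_trans le_de).
by rewrite eqT ?eqT'.
Qed.

(** Reflection in the antidiagonal, the form that transposing an equation C N = 0 gives to C when N
    is the reversed transpose of a matrix. *)
Definition reverse_mx A : 'M[K]_n := row_perm (w0 n) (col_perm (w0 n) A^T).

Lemma w0K : (w0 n * w0 n = 1)%g.
Proof. by apply/permP => i; rewrite permM !permE rev_ordK. Qed.

Lemma w0_invol i : w0 n (w0 n i) = i.
Proof. by rewrite -permM w0K perm1. Qed.

Lemma w0V : (w0 n)^-1%g = w0 n.
Proof. by apply/permP => i; apply: (@perm_inj _ (w0 n)); rewrite permKV w0_invol. Qed.

Lemma reverse_mx_unit A : A \in unitmx -> reverse_mx A \in unitmx.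
Proof. by move=> unitA; rewrite /reverse_mx row_permE col_permE !unitmx_mul !unitmx_perm unitmx_tr unitA. Qed.

Lemma row_span1P A d : reflect (forall i m : 'I_n, (i < d)%N -> (d <= m)%N -> A i m = 0)
  (row_span A d <= row_span (1%:M : 'M[K]_n) d)%VS.
Proof.
apply: (iffP (row_span_subP _ _ _)) => [h i m /h/row_spanP[c c0] + le_m|h i lt_i].
  by rewrite mulmx1 => /rowP/(_ m); rewrite mxE => ->; apply: c0.
by apply/row_spanP; exists (row i A); rewrite ?mulmx1 // => m le_m; rewrite mxE h.
Qed.

End Flags.

(** * Annihilating columns and the dual flag *)

Section Duality.
Variables (K : fieldType) (n : nat) (a : seq nat).
Hypothesis flag_a : flag_dims n a.
Implicit Types (w v : 'S_n) (A B C T Phi : 'M[K]_n).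

Let flag_a' := flag_dual_dims flag_a.

Definition dual_cols T : 'M[K]_(n, last 0%N (dual_dims n a)) :=
  (top_rows flag_a' T *m perm_mx (w0 n))^T.

Definition annihilates C (N : 'M[K]_(n, last 0%N (dual_dims n a))) :=
  forall p, p \in zero_index n a -> (top_rows flag_a C *m N) p.1 p.2 = 0.

Lemma dual_colsE T l j : dual_cols T l j = T (widen_ord (flag_last_le flag_a') j) (w0 n l).
Proof. by rewrite mxE -{1}w0V -col_permE !mxE. Qed.

Lemma mul_dual_cols C T i j :
  (C *m dual_cols T) i j = (T *m reverse_mx C) (widen_ord (flag_last_le flag_a') j) (w0 n i).
Proof.
rewrite !mxE (reindex_inj (@perm_inj _ (w0 n))); apply: eq_bigr => l _.
by rewrite dual_colsE !mxE !w0_invol mulrC.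
Qed.

(** By [mul_dual_cols] the equations say that [T *m reverse_mx C] is block lower triangular.
    Comparing dimensions, C thus determines the whole dual flag of T. *)
Lemma annihilatesP C T : C \in unitmx -> T \in unitmx ->
  annihilates C (dual_cols T) <->
  R_flag (dual_dims n a) T = R_flag (dual_dims n a) (invmx (reverse_mx C)).
Proof.
move=> unitC unitT; have unitH := reverse_mx_unit unitC.
split=> [ann|/R_flag_eqP eqT [i j]].
  apply/R_flag_eqP => _ /dual_dimsP[d da ->].
  have /andP[d_gt0 lt_dn] := flag_dims_bound flag_a da.
  apply/eqP; rewrite eqEdim; apply/andP; split; last first.
    by rewrite !dim_row_span ?row_free_unit ?unitmx_inv ?leq_subr.
  rewrite -{1}(mulmxK unitH T) -[invmx _]mul1mx mulmxA mulmx1.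
  apply: row_spanMr; apply/row_span1P => j m lt_j le_m.
  pose j' := Ordinal (leq_trans lt_j (dual_last_ge flag_a da)).
  have lt_m : (w0 n m < d)%N by rewrite permE /=; move: (ltn_ord m); lia.
  pose i' := Ordinal (leq_trans lt_m (flag_dims_last flag_a da)).
  have mem_ij : (i', j') \in zero_index n a.
    by rewrite inE; apply/hasP; exists d; rewrite //= lt_m.
  have := ann _ mem_ij; rewrite /= mul_rowsub_mx mxE mul_dual_cols; set i'' := widen_ord _ i';
    set j'' := widen_ord _ j'.
  have -> : i'' = w0 n m by apply: val_inj.
  by rewrite w0_invol; have -> : j'' = j by apply: val_inj.
rewrite inE /= => /hasP[d da /andP[lt_i lt_j]].
rewrite mul_rowsub_mx mxE mul_dual_cols.
have : (row_span (T *m reverse_mx C) (n - d) <= row_span (1%:M : 'M[K]_n) (n - d))%VS.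
  by rewrite -(mulVmx unitH) row_spanMr // eqT // mem_dual_dims.
move/row_span1P; apply => //; rewrite permE /=.
by move: (ltn_ord i) (flag_dims_last flag_a da); lia.
Qed.

(** The first d positions have the same set of values under v and w, by cardinality, and the rank at
    d depends only on that set. *)
Lemma rk_eq_of_disjoint v w d q :
  (forall i k : 'I_n, (i < d)%N -> (d <= k)%N -> v i != w k) -> rk v d q = rk w d q.
Proof.
move=> disj; pose s := (v * w^-1)%g; have ws i : w (s i) = v i by rewrite permM permKV.
pose D : {set 'I_n} := [set i : 'I_n | (i < d)%N].
have sD : s @: D = D.
  apply/eqP; rewrite eqEcard card_imset ?leqnn ?andbT; last exact: perm_inj.
  apply/fintype.subsetP => _ /imsetP[i + ->]; rewrite !inE => lt_i.
  by rewrite ltnNge; apply/negP => /(disj i _ lt_i); rewrite ws eqxx.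
rewrite /rk -!sum1_card [RHS](reindex_inj (@perm_inj _ s)); apply: eq_bigl => i.
rewrite !inE ws; congr (_ && _).
have : (s i \in D) = (i \in D) by rewrite -{1}sD mem_imset //; apply: perm_inj.
by rewrite !inE.
Qed.

(** Row i of T ends at v i and the column begins at w (w0 j); when these agree, one term 1 * 1
    survives. *)
Lemma mul_dual_cols_neq0 v w T T' (i j : 'I_n) (j' : 'I_(last 0%N (dual_dims n a))) :
  reduced v T -> reduced (w0 n * w * w0 n)%g T' -> widen_ord (flag_last_le flag_a') j' = j ->
  v i = w (w0 n j) -> (T *m dual_cols T') i j' != 0.
Proof.
move=> [T1 T0 _] [T1' T0' _] def_j eq_vw; rewrite mxE (bigD1 (v i)) //= big1 ?addr0; last first.
  move=> l neq_l; rewrite dual_colsE def_j.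
  case: (ltngtP (v i) l) => [lt_l|gt_l|/val_inj eq_l]; last by rewrite eq_l eqxx in neq_l.
    by rewrite T0 ?mul0r.
  rewrite T0' ?mulr0 // !permM -eq_vw !permE /=.
  by move: (ltn_ord (v i)); lia.
rewrite dual_colsE def_j T1 mul1r (_ : w0 n (v i) = (w0 n * w * w0 n)%g j) ?T1' ?oner_eq0 //.
by rewrite !permM eq_vw.
Qed.

(** If v i = w k with i < d <= k, the nonvanishing product involves a row of T in the span of the
    first d rows of C, all of which annihilate that column. *)
Lemma annihilates_perm_eq v w T T' C : in_Wa a v -> in_Wa a w ->
  reduced v T -> reduced (w0 n * w * w0 n)%g T' -> R_flag a C = R_flag a T ->
  annihilates C (dual_cols T') -> v = w.
Proof.
move=> Wav Waw redT redT' /R_flag_eqP eqCT ann; apply: (rk_inj_Wa Wav Waw) => d q da.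
apply: rk_eq_of_disjoint => i k lt_i le_k; apply/eqP => eq_vw.
have lt_k : (w0 n k < n - d)%N by rewrite permE /=; move: (ltn_ord k); lia.
pose j' := Ordinal (leq_trans lt_k (dual_last_ge flag_a da)).
have := @mul_dual_cols_neq0 v w T T' i (w0 n k) j' redT redT'.
rewrite w0_invol => /(_ (val_inj _) eq_vw); case/(_ erefl)/eqP.
have : row i T \in row_span C d by rewrite eqCT // mem_row_span.
case/row_spanP=> c c0 def_row.
have -> : (T *m dual_cols T') i j' = (row i T *m dual_cols T') 0 j' by rewrite -row_mul [RHS]mxE.
rewrite def_row -mulmxA mxE big1 // => l _.
case: (ltnP l d) => [lt_l|/c0 ->]; last by rewrite mul0r.
have mem_lj : (Ordinal (leq_trans lt_l (flag_dims_last flag_a da)), j') \in zero_index n a.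
  by rewrite inE; apply/hasP; exists d; rewrite //= lt_l.
have := ann _ mem_lj; rewrite /= mul_rowsub_mx mxE; set l' := widen_ord _ _.
by have -> : l' = l by [apply: val_inj]; move=> ->; rewrite mulr0.
Qed.

Lemma dual_dimsK : dual_dims n (dual_dims n a) = a.
Proof.
rewrite /dual_dims map_rev revK -map_comp -[RHS]map_id; apply/eq_in_map => d da /=.
by have /andP[_ /ltnW] := flag_dims_bound flag_a da; apply: subKn.
Qed.

Lemma w0_conjK w : (w0 n * (w0 n * w * w0 n) * w0 n = w)%g.
Proof. by rewrite !mulgA w0K mul1g -mulgA w0K mulg1. Qed.

Lemma local_N_reduced w (N : 'M[K]_(n, last 0%N (dual_dims n a))) :
  local_N a w N <-> exists2 T, reduced (w0 n * w * w0 n)%g T & N = dual_cols T.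
Proof.
split=> [[M /(local_M_reduced flag_a')[T redT ->] <-]|[T redT ->]]; first by exists T.
by exists (top_rows flag_a' T) => //; apply/(local_M_reduced flag_a'); exists T.
Qed.

(** The dual flag has a reduced matrix for some permutation; the pairing with T identifies it as the
    dual of w, without computing the position of the dual flag. *)
Lemma exists_annihilator w T C : in_Wa a w -> reduced w T -> C \in unitmx ->
  R_flag a C = R_flag a T -> exists2 N, local_N a w N & annihilates C N.
Proof.
move=> Waw redT unitC eqCT.
have /partial_flag_R_flag : invmx (reverse_mx C) \in unitmx by rewrite unitmx_inv reverse_mx_unit.
move=> /(_ _ flag_a')/(exists_reduced_span flag_a')[v [T' [Wav redT' eqT']]].
have ann : annihilates C (dual_cols T') by apply/annihilatesP; rewrite ?(reduced_unit redT').
pose u := (w0 n * v * w0 n)%g; have def_v : v = (w0 n * u * w0 n)%g by rewrite w0_conjK.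
have Wau : in_Wa a u by have := in_Wa_dual flag_a' Wav; rewrite dual_dimsK.
have eq_wu : w = u.
  by apply: (annihilates_perm_eq Waw Wau redT _ eqCT ann); rewrite -def_v.
by exists (dual_cols T') => //; apply/local_N_reduced; exists T'; rewrite // eq_wu -def_v.
Qed.

Lemma annihilator_inj w C N N' : in_Wa a w -> C \in unitmx ->
  local_N a w N -> local_N a w N' -> annihilates C N -> annihilates C N' -> N = N'.
Proof.
move=> Waw unitC /local_N_reduced[T redT ->] /local_N_reduced[T' redT' ->].
move=> /annihilatesP eqT /annihilatesP eqT'; congr ((_ *m _)^T).
have unitT := reduced_unit redT; have unitT' := reduced_unit redT'.
exact: top_rows_inj (in_Wa_dual flag_a Waw) redT redT' (eqT unitC unitT) (eqT' unitC unitT').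
Qed.

End Duality.

(** * Common zeroes, equations and variables *)

Section CommonZeroes.
Variables (K : fieldType) (n : nat) (a : seq nat).
Hypothesis flag_a : flag_dims n a.

Lemma schubert_of_reduced (w : 'S_n) (T Phi : 'M[K]_n) : reduced w T -> Phi \in unitmx ->
  schubert_variety a w (R_complete Phi) (R_flag a (T *m Phi)).
Proof.
move=> redT unitPhi; split=> [|m j]; last by rewrite (dim_R_flag_cap _ _ redT).
by apply: (partial_flag_R_flag flag_a); rewrite unitmx_mul (reduced_unit redT).
Qed.

(** All points of the intersection lie in the open cells. Only flags enter, so the choice of
    matrices does not matter. *)
Definition general_position s (w : 'I_s -> 'S_n) (F : 'I_s -> subspaces K n n) :=
  forall V : subspaces K (size a) n, (forall i, schubert_variety a (w i) (F i) V) ->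
  forall i (m : 'I_(size a)) (j : 'I_n), \dim (V m :&: F i j) = rk (w i) (nth 0%N a m) j.+1.

Lemma general_position_reduced s (w : 'I_s -> 'S_n) (Phi : 'I_s -> 'M[K]_n) V l :
  in_Wa a (w l) -> (forall i, Phi i \in unitmx) ->
  general_position w (fun i => R_complete (Phi i)) ->
  (forall i, schubert_variety a (w i) (R_complete (Phi i)) V) ->
  exists2 T, reduced (w l) T & V = R_flag a (T *m Phi l).
Proof.
move=> Waw unitPhi gp_w V_X; have [partV _] := V_X l.
have [v [T [Wav redT def_V]]] := exists_reduced_flag flag_a (unitPhi l) partV.
exists T => //; suff <- : v = w l by [].
apply: (rk_inj_Wa Wav Waw) => d q da; apply: (rk_ext_flag flag_a (R := eq)) => // m j.
by rewrite -(gp_w V V_X) def_V (dim_R_flag_cap _ _ redT).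
Qed.

Lemma eq_R_flag_mulr (A B C : 'M[K]_n) :
  R_flag a A = R_flag a B -> R_flag a (A *m C) = R_flag a (B *m C).
Proof.
by move=> /R_flag_eqP eqAB; apply/R_flag_eqP => d da; apply/eq_row_spanMr/eqAB.
Qed.

Lemma common_zeroes_bij r (w : 'I_r.+1 -> 'S_n) (Phi : 'I_r.+1 -> 'M[K]_n) :
  (forall l, in_Wa a (w l)) -> (forall l, Phi l \in unitmx) ->
  general_position w (fun l => R_complete (Phi l)) ->
  set_bij (common_zeroes a w Phi)
    (\bigcap_(l in [set: 'I_r.+1]) schubert_variety a (w l) (R_complete (Phi l)))%classic
    (fun x => R_flag a (x.1 *m Phi ord_max)).
Proof.
move=> Waw unitPhi gp_w; pose last_l := @ord_max r.
pose wid (l : 'I_r) := widen_ord (leqnSn r) l.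
pose C (T : 'M[K]_n) (l : 'I_r) := T *m Phi last_l *m invmx (Phi (wid l)).
have unitC (v : 'S_n) (T : 'M[K]_n) l : reduced v T -> C T l \in unitmx.
  by move=> redT; rewrite !unitmx_mul (reduced_unit redT) unitmx_inv !unitPhi.
have zeroesP x : common_zeroes a w Phi x <-> exists T, [/\ reduced (w last_l) T,
    x.1 = top_rows flag_a T & forall l, local_N a (w (wid l)) (x.2 l) /\
    annihilates flag_a (C T l) (x.2 l)].
  split=> [[[/(local_M_reduced flag_a)[T redT def_M] locN] eqs]|[T [redT def_M locN]]].
    exists T; split=> // l; split=> // p p_in.
    have := eqs (l, p); rewrite !inE /equation_lhs /= def_M !mul_rowsub_mx; apply.
    by move: p_in; rewrite inE.
  split; first by split=> [|l]; [apply/(local_M_reduced flag_a); exists T | have [] := locN l].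
  move=> [l p]; rewrite !inE /= => p_in; have [_ ann] := locN l.
  have := ann p; rewrite inE => /(_ p_in) <-.
  by rewrite /equation_lhs /= def_M /top_rows !mul_rowsub_mx.
split.
- move=> x /zeroesP[T [redT def_M locN]] l _ /=; rewrite def_M R_flag_top_rows.
  have [lt_lr|le_rl] := ltnP l r; last first.
    have -> : l = last_l by apply: val_inj => /=; move: (ltn_ord l); lia.
    exact: schubert_of_reduced.
  have -> : l = wid (Ordinal lt_lr) by apply: val_inj.
  move: (Ordinal lt_lr) => {lt_lr}l; have [/local_N_reduced[T' redT' ->] ann] := locN l.
  have unitTP : T *m Phi last_l \in unitmx by rewrite unitmx_mul (reduced_unit redT) unitPhi.
  (* The point lies in some cell relative to [Phi (wid l)]; the equations force it to be that of
     [w (wid l)]. *)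
  have [v [T2 [Wav redT2 def_V]]] :=
    exists_reduced_flag flag_a (unitPhi (wid l)) (partial_flag_R_flag flag_a unitTP).
  rewrite -/last_l def_V; suff <- : v = w (wid l) by apply: schubert_of_reduced.
  apply: (annihilates_perm_eq Wav (Waw _) redT2 redT' _ ann).
  by rewrite /C (eq_R_flag_mulr _ def_V) mulmxK.
- move=> [M N] [M' N']; rewrite !inE => /zeroesP[T [redT /= -> locN]] /zeroesP[T' [redT' /= -> locN']].
  rewrite !R_flag_top_rows => /(eq_R_flag_mulr (invmx (Phi last_l))); rewrite !mulmxK // => eqT.
  have eq_top : top_rows flag_a T = top_rows flag_a T' by apply: top_rows_inj (Waw _) redT redT' eqT _.
  congr pair => //; apply/funext => l; have [locNl annl] := locN l; have [locNl' annl'] := locN' l.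
  apply: (annihilator_inj (Waw (wid l)) (unitC _ _ l redT) locNl locNl' annl).
  (* The equations see T only through its top rows. *)
  have eqC : top_rows flag_a (C T l) = top_rows flag_a (C T' l).
    by rewrite /top_rows /C -!mul_rowsub_mx -/(top_rows flag_a T) eq_top.
  by move=> p p_in; rewrite eqC annl'.
move=> V V_X; have {}V_X l : schubert_variety a (w l) (R_complete (Phi l)) V by apply: V_X.
(* General position supplies M here, and below the annihilators N. *)
have [T redT def_V] := general_position_reduced (Waw last_l) unitPhi gp_w V_X.
have : forall l : 'I_r, exists N, local_N a (w (wid l)) N /\ annihilates flag_a (C T l) N.
  move=> l; have [T' redT' def_V'] := general_position_reduced (Waw (wid l)) unitPhi gp_w V_X.
  have [|N] := exists_annihilator flag_a (Waw (wid l)) redT' (unitC _ _ l redT).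
    by rewrite /C (@eq_R_flag_mulr _ (T' *m Phi (wid l))) ?mulmxK // -def_V.
  by exists N.
case/boolp.choice=> N locN; exists (top_rows flag_a T, N) => /=.
  by apply/zeroesP; exists T.
by rewrite R_flag_top_rows.
Qed.

End CommonZeroes.

Section Counting.
Variables (n : nat) (a : seq nat).
Hypothesis flag_a : flag_dims n a.

Lemma sum_perm_length s (w : 'I_s.+1 -> 'S_n) : schubert_problem a w ->
  (\sum_l perm_length (w l) = s * dim_flags n a)%N.
Proof.
case=> Waw sum_codim; apply/eqP; rewrite -(eqn_add2r (dim_flags n a)) -{1}sum_codim -big_split /=.
rewrite (eq_bigr (fun=> dim_flags n a)); first by rewrite sum_nat_const card_ord mulSn addnC.
by move=> l _; rewrite /codim subnKC // perm_length_le_dim.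
Qed.

Lemma card_equations r : #|equations n a r| = (r * dim_flags n a)%N.
Proof. by rewrite cardsX cardsT card_ord card_zero_index. Qed.

Lemma card_variables r (w : 'I_r.+1 -> 'S_n) : schubert_problem a w ->
  #|variables a w| = (r * dim_flags n a)%N.
Proof.
move=> schub; have [Waw _] := schub; rewrite -(sum_perm_length schub) big_ord_recr /= addnC.
rewrite -sum1_card big_sumType /=; congr (_ + _)%N.
  rewrite -(card_free flag_a (Waw ord_max)) sum1_card.
  apply: eq_card => -[i j]; rewrite [LHS](_ : _ = (inl (i, j) \in variables a w)) //.
  by rewrite !inE.
transitivity (\sum_(l < r) \sum_(p | inr (l, p) \in variables a w) 1)%N.
  by rewrite pair_big_dep /=; apply: eq_bigl => -[l p].
apply: eq_bigr => l _; set u := w (widen_ord _ l).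
have flag_a' := flag_dual_dims flag_a.
rewrite -perm_length_dual -(card_free flag_a' (in_Wa_dual flag_a (Waw (widen_ord (leqnSn r) l)))).
pose f (p : 'I_n * 'I_(last 0%N (dual_dims n a))) := (p.2, w0 n p.1).
have f_inj : injective f by case=> [i j] [i' j'] [] -> /perm_inj ->.
have varE p : (inr (l, p) \in variables a w) =
    (p \in [set p | is_free (dual_dims n a) (w0 n * u * w0 n)%g (f p).1 (f p).2]).
  by case: p => p q; rewrite !inE.
rewrite (eq_bigl _ _ varE) sum1_card -(card_imset _ f_inj); apply: eq_card => -[q k].
apply/imsetP/idP => [[p + ->]|free]; first by rewrite !inE.
by exists (w0 n k, q); rewrite ?inE /f /= ?w0_invol // inE in free *.
Qed.

End Counting.

Lemma exists_unique_local_M (K : fieldType) n a (flag_a : flag_dims n a) (w : 'S_n)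
    (y : 'I_(last 0%N a) -> 'I_n -> K) :
  exists! M, local_M a w M /\ forall i j, is_free a w i j -> M i j = y i j.
Proof.
pose M := \matrix_(i, j) if is_one a w i j then 1 else if is_zero a w i j then 0 else y i j.
exists M; split.
  split=> i j; last by rewrite mxE /is_free; case: ifP => // _; case: ifP.
  split; rewrite mxE; first by move=> ->.
  (* No position is prescribed to be both 1 and 0. *)
  case: ifP => [|_ -> //]; rewrite (is_oneE flag_a) => /eqP -> /(is_zeroP flag_a)[|[k lt_ki /perm_inj eq_k]].
    by rewrite ltnn.
  by rewrite -eq_k ltnn in lt_ki.
move=> M' [locM' freeM']; apply/matrixP => i j; rewrite mxE; have [M1 M0] := locM' i j.
case: ifP => [/M1 -> //|not1]; case: ifP => [/M0 -> //|not0].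
by rewrite freeM' // /is_free not1 not0.
Qed.

Lemma exists_unique_coordinates (K : fieldType) n a (flag_a : flag_dims n a) r
    (w : 'I_r.+1 -> 'S_n) (y : entry_position n a r -> K) :
  exists! x, local_coordinates a w x /\ {in variables a w, entry x =1 y}.
Proof.
have flag_a' := flag_dual_dims flag_a.
have [M [[locM freeM] uniqM]] := exists_unique_local_M flag_a (w ord_max) (fun i j => y (inl (i, j))).
pose u (l : 'I_r) := (w0 n * w (widen_ord (leqnSn r) l) * w0 n)%g.
have /boolp.choice[N' N'P] := fun l : 'I_r =>
  exists_unique_local_M flag_a' (u l) (fun q k => y (inr (l, (w0 n k, q)))).
have dualE (A : 'M[K]_(last 0%N (dual_dims n a), n)) p q :
    (A *m perm_mx (w0 n))^T p q = A q (w0 n p).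
  by rewrite mxE -{1}w0V -col_permE mxE.
exists (M, fun l => (N' l *m perm_mx (w0 n))^T); split.
  split; first by split=> // l; exists (N' l) => //; have [[]] := N'P l.
  case=> [[i j]|[l [p q]]]; rewrite inE /=; first exact: freeM.
  have [[_ freeN] _] := N'P l; rewrite dualE => /freeN ->.
  by rewrite w0_invol.
move=> [M1 N1] [[/= locM1 locN1] freeMN]; congr pair.
  by apply: uniqM; split=> // i j free_ij; apply: (freeMN (inl (i, j))); rewrite inE.
apply/funext => l; have [A locA def_N] := locN1 l; rewrite -def_N; congr ((_ *m _)^T).
have [_ uniqN] := N'P l; apply: uniqN; split=> // q k free_qk.
have <- : entry (M1, N1) (inr (l, (w0 n k, q))) = A q k by rewrite /= -def_N dualE w0_invol.
by apply: freeMN; rewrite inE w0_invol.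
Qed.

(** * Algebraic dependence *)

Section AlgebraicDependence.
Variable K : fieldType.

Lemma msize_prod_le k (I : Type) (s : seq I) (P : pred I) (F : I -> {mpoly K[k]}) (d : I -> nat) :
  (forall i, msize (F i) <= (d i).+1)%N ->
  (msize (\prod_(i <- s | P i) F i) <= (\sum_(i <- s | P i) d i).+1)%N.
Proof.
move=> leF; elim/big_rec2: _ => [|i e p _ le_p]; first by rewrite msize1.
have [->|nz_F] := eqVneq (F i) 0; first by rewrite mul0r msize0.
have [->|nz_p] := eqVneq p 0; first by rewrite mulr0 msize0.
rewrite msizeM // -subn1 leq_subLR.
by apply: leq_trans (leq_add (leF i) le_p) _; rewrite addSn addnS.
Qed.

(* Monomials with exponents below D in m unknowns pull back to polynomials of   *)
(* degree O(D) in k < m variables, so for large D there are more of them, D^m,  *)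
(* than available coefficients, O(D^k).                                         *)
Lemma exists_algebraic_relation k m (lq : m.-tuple {mpoly K[k]}) : (k < m)%N ->
  exists2 p : {mpoly K[m]}, p != 0 & p \mPo lq = 0.
Proof.
move=> lt_km; pose delta := \max_(i < m) msize (tnth lq i).
(* d bounds the degree of a substituted monomial. As d + 1 <= c D, there are at most c^k D^k
   coefficients, fewer than D^(k+1) <= D^m monomials. *)
pose c := (m * delta).+1; pose D := (c ^ k).+1; pose d := (m * delta * D)%N.
pose E := {ffun 'I_m -> 'I_D}; pose G := {ffun 'I_k -> 'I_d.+1}.
pose monE (e : E) : 'X_{1..m} := [multinom (e i : nat) | i < m].
pose monG (g : G) : 'X_{1..k} := [multinom (g i : nat) | i < k].
pose q e := 'X_[K, monE e] \mPo lq.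
have size_q e : (msize (q e) <= d.+1)%N.
  rewrite /q comp_mpolyX.
  apply: leq_trans (msize_prod_le (d := fun i => (delta * e i)%N) _ _ _) _ => [i|].
    rewrite mnmE -[X in _ ^+ X]card_ord -prodr_const.
    apply: leq_trans (msize_prod_le (d := fun=> delta) _ _ _) _ => [_|].
      exact/leqW/(leq_bigmax i).
    by rewrite sum_nat_const card_ord mulnC.
  rewrite ltnS /d -mulnA -[X in (_ <= X * _)%N](card_ord m) -sum_nat_const.
  by apply: leq_sum => i _; rewrite leq_mul2l ltnW ?orbT.
have monE_inj : injective monE.
  move=> e e' /mnmP eq_e; apply/ffunP => i; apply: val_inj.
  by have := eq_e i; rewrite !mnmE.
have lt_GE : (#|{: G}| < #|{: E}|)%N.
  rewrite !card_ffun !card_ord; apply: leq_ltn_trans (_ : (c * D) ^ k < _)%N.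
    have le_exp x y e : (x <= y)%N -> (x ^ e <= y ^ e)%N.
      by move=> le_xy; elim: e => // e IH; rewrite !expnS leq_mul.
    by apply: le_exp; rewrite /d mulSn addnC -addn1 leq_add.
  rewrite expnMn; apply: leq_trans (_ : D * D ^ k <= _)%N.
    by rewrite ltn_mul2r expn_gt0 /= ltnSn.
  by rewrite -expnS leq_pexp2l.
pose A : 'M[K]_(#|{: E}|, #|{: G}|) := \matrix_(i, j) (q (enum_val i))@_(monG (enum_val j)).
have : kermx A != 0.
  rewrite kermx_eq0 /row_free neq_ltn; apply/orP; left.
  by apply: leq_ltn_trans (rank_leq_col A) lt_GE.
rewrite -nz_row_eq0; set b := nz_row _ => nz_b.
have bA0 : b *m A = 0 by apply/sub_kermxP; apply: nz_row_sub.
exists (\sum_i b 0 i *: 'X_[monE (enum_val i)]).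
  have [i nz_bi] := rV0Pn _ nz_b; apply: contraNneq nz_bi => /(congr1 (mcoeff (monE (enum_val i)))).
  rewrite mcoeff0 raddf_sum (bigD1 i) //= mcoeffZ mcoeffX eqxx mulr1 big1 ?addr0 => [-> //|j neq_ji].
  by rewrite mcoeffZ mcoeffX (inj_eq monE_inj) (inj_eq enum_val_inj) (negPf neq_ji) mulr0.
rewrite raddf_sum; apply/mpolyP => mu; rewrite mcoeff0 raddf_sum /=.
have [le_mu|lt_mu] := leqP (mdeg mu) d; last first.
  rewrite big1 // => i _; rewrite comp_mpolyZ mcoeffZ (memN_msupp_eq0 (msize_mdeg_ge _)) ?mulr0 //.
  exact: leq_trans (size_q _) lt_mu.
have le_mui i : (mu i < d.+1)%N.
  by rewrite ltnS (leq_trans _ le_mu) // mdegE (bigD1 i) //= leq_addr.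
pose g : G := [ffun i => Ordinal (le_mui i)].
have def_mu : monG g = mu by apply/mnmP => i; rewrite mnmE ffunE.
have /rowP/(_ (enum_rank g)) := bA0; rewrite !mxE => eq0; rewrite -[RHS]eq0.
by apply: eq_bigr => i _; rewrite comp_mpolyZ mcoeffZ mxE enum_rankK def_mu.
Qed.

End AlgebraicDependence.

(** * Nonzero polynomials have nonzero values *)

Lemma base_digits_inj B k (f g : nat -> nat) :
  (forall i, (i < k)%N -> (f i < B)%N) -> (forall i, (i < k)%N -> (g i < B)%N) ->
  (\sum_(i < k) f i * B ^ i = \sum_(i < k) g i * B ^ i)%N ->
  forall i, (i < k)%N -> f i = g i.
Proof.
elim: k f g => [//|k IH] f g ltf ltg.
have split_low (h : nat -> nat) :
    (\sum_(i < k.+1) h i * B ^ i = (\sum_(i < k) h i.+1 * B ^ i) * B + h 0)%N.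
  rewrite big_ord_recl expn0 muln1 addnC; congr (_ + _)%N.
  by rewrite big_distrl /=; apply: eq_bigr => i _; rewrite -mulnA -expnSr.
rewrite !split_low => eq_fg.
have := congr1 (modn^~ B) eq_fg; rewrite !modnMDl !modn_small ?ltf ?ltg // => eq0.
have B_gt0 : (0 < B)%N by apply: leq_trans (ltf 0%N _).
have := congr1 (divn^~ B) eq_fg; rewrite !divnMDl // !divn_small ?ltf ?ltg // !addn0 => eqS.
case=> [//|i]; apply: (IH (fun i => f i.+1) (fun i => g i.+1)) => // j lt_j.
  exact: ltf.
exact: ltg.
Qed.

(* Kronecker substitution: evaluating at the powers t ^ (B ^ i), with B larger  *)
(* than all exponents of p, keeps the monomials of p distinct.                  *)
Lemma exists_meval_neq0 (K : numFieldType) k (p : {mpoly K[k]}) : p != 0 ->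
  exists x, p.@[x] != 0.
Proof.
move=> nz_p; pose B := msize p.
pose x (t : K) (i : 'I_k) := t ^+ (B ^ i).
pose code (mu : 'X_{1..k}) := (\sum_(i < k) mu i * B ^ i)%N.
pose h : {poly K} := \sum_(mu <- msupp p) p@_mu *: 'X^(code mu).
have h_eval t : h.[t] = p.@[x t].
  rewrite mevalE horner_sum; apply: eq_bigr => mu _; rewrite hornerZ hornerXn.
  by rewrite /code -prodrXr; congr (_ * _); apply: eq_bigr => i _; rewrite -exprM mulnC.
have lt_B mu i : mu \in msupp p -> (mu i < B)%N.
  by move=> /msize_mdeg_lt; apply: leq_ltn_trans; rewrite mdegE (bigD1 i) //= leq_addr.
have code_inj : {in msupp p &, injective code}.
  move=> mu nu mu_p nu_p; pose ext (m : 'X_{1..k}) i := if insub i is Some j then m j else 0%N.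
  have extE m (i : 'I_k) : ext m i = m i by rewrite /ext valK.
  have codeE m : code m = (\sum_(i < k) ext m i * B ^ i)%N.
    by apply: eq_bigr => i _; rewrite extE.
  rewrite !codeE => eq_code.
  have lt_ext m i : m \in msupp p -> (i < k)%N -> (ext m i < B)%N.
    by move=> m_p lt_i; rewrite (extE m (Ordinal lt_i)) lt_B.
  apply/mnmP => i; rewrite -!extE.
  apply: (@base_digits_inj B k (ext mu) (ext nu) _ _ eq_code i (ltn_ord i)) => j;
  exact: lt_ext.
have nz_h : h != 0.
  have [mu mu_p] : exists mu, mu \in msupp p.
    case E : (msupp p) => [|mu s]; last by exists mu; rewrite mem_head.
    by move: nz_p; rewrite -msupp_eq0 E.
  move: (mu_p); rewrite mcoeff_msupp; apply: contraNneq => /(congr1 (coefp (code mu))).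
  rewrite /coefp coef0 coef_sum (bigD1_seq mu) ?msupp_uniq //= coefZ coefXn eqxx mulr1.
  rewrite big_seq_cond big1 ?addr0 => [-> //|nu /andP[nu_p neq_nu]].
  rewrite coefZ coefXn; case: eqP => [/code_inj eq_nu|_]; last by rewrite mulr0.
  by rewrite eq_nu ?eqxx // in neq_nu.
(* The first [size h] natural numbers are distinct in characteristic zero, too many to be all roots
   of h. *)
have [t nz_ht] : exists t, h.[t] != 0.
  pose ts : seq K := [seq i%:R | i <- iota 0 (size h)].
  case: (boolP (all (root h) ts)) => [rts|/allPn[t _ nz]]; last by exists t.
  have := max_poly_roots nz_h rts; rewrite map_inj_uniq ?iota_uniq; last first.
    by move=> i j /eqP; rewrite Num.Theory.eqr_nat => /eqP.
  by rewrite size_map size_iota ltnn => /(_ isT).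
by exists (x t); rewrite -h_eval.
Qed.

(** * Polynomial maps to tuples of matrices *)

Section PolynomialMatrices.
Variables (K : fieldType) (n s : nat).
Notation coord := ('I_s * ('I_n * 'I_n))%type.

Definition coord_tuple k (Q : 'I_s -> 'M[{mpoly K[k]}]_n) : #|{: coord}|.-tuple {mpoly K[k]} :=
  [tuple (let: (i, (p, q)) := enum_val j in Q i p q) | j < #|{: coord}|].

Lemma meval_coord_tuple k (Q : 'I_s -> 'M[{mpoly K[k]}]_n) p x :
  (p \mPo coord_tuple Q).@[x] = p.@[tuple_coords (fun i => map_mx (meval x) (Q i))].
Proof.
rewrite comp_mpoly_meval; apply: meval_eq => j; rewrite tnth_mktuple /tuple_coords.
by case: (enum_val j) => i [q1 q2]; rewrite mxE.
Qed.

Definition generic_mx (i : 'I_s) : 'M[{mpoly K[#|{: coord}|]}]_n :=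
  \matrix_(p, q) 'X_(enum_rank (i, (p, q))).

Definition mx_of_coords (x : 'I_#|{: coord}| -> K) (i : 'I_s) : 'M[K]_n :=
  \matrix_(p, q) x (enum_rank (i, (p, q))).

Lemma map_generic_mx x i : map_mx (meval x) (generic_mx i) = mx_of_coords x i.
Proof. by apply/matrixP => p q; rewrite !mxE mevalXU. Qed.

Lemma mx_of_coordsK x : tuple_coords (mx_of_coords x) =1 x.
Proof.
move=> j; rewrite /tuple_coords -[in RHS](enum_valK j).
by case: (enum_val j) => i [p q]; rewrite mxE.
Qed.

Lemma tuple_coordsK (Phi : 'I_s -> 'M[K]_n) i : mx_of_coords (tuple_coords Phi) i = Phi i.
Proof. by apply/matrixP => p q; rewrite mxE /tuple_coords enum_rankK. Qed.

Lemma det_generic_mx_neq0 i : \det (generic_mx i) != 0.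
Proof.
apply/eqP => /(congr1 (meval (tuple_coords (fun=> 1%:M)))) /=.
rewrite -det_map_mx map_generic_mx tuple_coordsK det1 meval0.
by apply/eqP; rewrite oner_eq0.
Qed.

Variables (k : finType) (Z : {set k}).

(** The variable attached to z, or 0 outside Z; the sum avoids carrying a membership proof. *)
Definition set_var (z : k) : {mpoly K[#|Z|]} :=
  \sum_(j < #|Z|) if enum_val j == z then 'X_j else 0.

Lemma meval_set_var (y : k -> K) z :
  (set_var z).@[fun j => y (enum_val j)] = if z \in Z then y z else 0.
Proof.
rewrite raddf_sum /= (eq_bigr (fun j => if enum_val j == z then y z else 0)) => [|j _]; last first.
  by case: eqP => [<-|_]; rewrite ?mevalXU ?meval0.
rewrite -(big_enum_val (fun t => if t == z then y z else 0)) /=.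
rewrite -big_mkcondr /=; case: ifP => zZ.
  by rewrite (big_pred1 z) // => t /=; case: eqP => [->|_]; rewrite ?zZ ?andbF.
by rewrite big1 // => t /andP[tZ /eqP eq_t]; rewrite -eq_t tZ in zZ.
Qed.

End PolynomialMatrices.

(** * General flags *)

Section Genericity.
Variables (K : fieldType) (n : nat) (a : seq nat) (s : nat).
Hypothesis flag_a : flag_dims n a.
Notation coord := ('I_s * ('I_n * 'I_n))%type.

Definition free_entries (v : 'S_n) : {set 'I_n * 'I_n} :=
  [set p : 'I_n * 'I_n | (p.1 < (v^-1)%g p.2)%N && (p.2 < v p.1)%N].

Lemma card_free_entries v : #|free_entries v| = perm_length v.
Proof.
pose f (p : 'I_n * 'I_n) := (p.1, v p.2).
have f_inj : injective f by case=> [i j] [i' j'] [] -> /perm_inj ->.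
rewrite /perm_length -(card_imset _ f_inj); apply: eq_card => -[i l]; rewrite !inE /=.
apply/andP/imsetP => [[lt_i lt_l]|[[i' k]]].
  by exists (i, (v^-1)%g l); rewrite ?inE /f /= permKV // lt_i.
by rewrite inE /= => /andP[lt_ik lt_v] [-> ->]; rewrite permK.
Qed.

Lemma reduced_entry_eq0 v (T : 'M[K]_n) (i l : 'I_n) : reduced v T ->
  l != v i -> (i, l) \notin free_entries v -> T i l = 0.
Proof.
move=> [_ T0 Tr] neq_l; rewrite inE /= negb_and -!leqNgt => /orP[le_i|le_v]; last first.
  by apply: T0; rewrite ltn_neqAle eq_sym -val_eqE /= in neq_l *; rewrite neq_l.
rewrite -(permKV v l); apply: Tr; rewrite ltn_neqAle le_i andbT.
by apply: contra neq_l => /eqP/val_inj <-; rewrite permKV.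
Qed.

(* Flags V = R_a(T) in the cell of the reduced matrices T for u, with V also in *)
(* the cell of v k relative to Phi k, give Phi k = adj(T_k) P_k T with T_k      *)
(* reduced for v k and P_k block lower triangular: fewer than s n^2 parameters. *)
Lemma exists_vanishing_cell (v : 'I_s -> 'S_n) (u : 'S_n) :
  (perm_length u + \sum_k perm_length (v k) < s * dim_flags n a)%N ->
  exists2 p : {mpoly K[#|{: coord}|]}, p != 0 &
    forall (Phi : 'I_s -> 'M[K]_n) (T : 'M[K]_n) (T' : 'I_s -> 'M[K]_n),
    reduced u T -> (forall k, reduced (v k) (T' k)) ->
    (forall k, R_flag a (T' k *m Phi k) = R_flag a T) -> p.@[tuple_coords Phi] = 0.
Proof.
move=> lt_dim.
pose Z := (('I_n * 'I_n) + 'I_s * (('I_n * 'I_n) + ('I_n * 'I_n)))%type.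
pose block := [set p : 'I_n * 'I_n | separated a p.1 p.2].
pose params : {set Z} := [set z : Z | match z with
  | inl p => p \in free_entries u
  | inr (k, inl p) => p \in free_entries (v k)
  | inr (k, inr p) => p \notin block end].
have card_params : (#|params| < #|{: coord}|)%N.
  have -> : #|params| = (perm_length u +
      \sum_k (perm_length (v k) + (n * n - dim_flags n a)))%N.
    rewrite -sum1_card big_sumType /=; congr (_ + _)%N.
      by rewrite -card_free_entries -sum1_card; apply: eq_bigl => p; rewrite inE.
    transitivity (\sum_(k < s) \sum_(z | inr (k, z) \in params) 1)%N.
      by rewrite pair_big_dep /=; apply: eq_bigl => -[k z].
    apply: eq_bigr => k _; rewrite big_sumType /=; congr (_ + _)%N.
      by rewrite -card_free_entries -sum1_card; apply: eq_bigl => p; rewrite inE.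
    have -> : (n * n - dim_flags n a)%N = #|(~: block)%SET|.
      by rewrite cardsCs finset.setCK card_prod card_ord -(card_separated flag_a).
    by rewrite -sum1_card; apply: eq_bigl => p; rewrite !inE.
  have le_dim : (dim_flags n a <= n * n)%N.
    by rewrite -(card_separated flag_a) (leq_trans (max_card _)) // card_prod card_ord.
  rewrite card_prod card_prod !card_ord big_split /= sum_nat_const card_ord.
  move: (leq_mul (leqnn s) le_dim) lt_dim; rewrite mulnBr.
  move: (s * (n * n))%N (s * dim_flags n a)%N (perm_length u).
  by move: (\sum_k _)%N; lia.
pose var z := set_var K params z.
pose Tpol (w : 'S_n) (emb : 'I_n * 'I_n -> Z) : 'M[{mpoly K[#|params|]}]_n :=
  \matrix_(i, l) if l == w i then 1 else var (emb (i, l)).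
pose Ppol k : 'M[{mpoly K[#|params|]}]_n := \matrix_(i, l) var (inr (k, inr (i, l))).
(* The adjugate keeps Q polynomial; the missing determinant is absorbed into [P]. *)
pose Q k := \adj (Tpol (v k) (fun p => inr (k, inl p))) *m Ppol k *m Tpol u inl.
have [p nz_p p_rel] := exists_algebraic_relation (coord_tuple Q) card_params.
exists p => // Phi T T' redT redT' eqT.
have unitT := reduced_unit redT.
pose P k := (\det (T' k))^-1 *: (T' k *m Phi k *m invmx T).
pose y (z : Z) := match z with
  | inl (i, l) => T i l
  | inr (k, inl (i, l)) => T' k i l
  | inr (k, inr (i, l)) => P k i l end.
pose x (j : 'I_#|params|) : K := y (enum_val j).
have evalT (w : 'S_n) (emb : 'I_n * 'I_n -> Z) (A : 'M[K]_n) : reduced w A ->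
    (forall i l, y (emb (i, l)) = A i l) ->
    (forall q, (emb q \in params) = (q \in free_entries w)) ->
    map_mx (meval x) (Tpol w emb) = A.
  move=> redA y_emb emb_in; apply/matrixP => i l; rewrite !mxE.
  case: eqP => [->|/eqP neq_l]; first by have [-> _ _] := redA; rewrite meval1.
  rewrite meval_set_var emb_in y_emb; case: ifPn => // notin.
  by rewrite (reduced_entry_eq0 redA).
have evalP k : map_mx (meval x) (Ppol k) = P k.
  apply/matrixP => i l; rewrite [LHS]mxE [X in meval _ X]mxE meval_set_var inE /=.
  case: ifPn => //; rewrite negbK inE /= => /separatedP[d [da lt_id le_dl]].
  (* [T' k *m Phi k] and T have the same span at each d in a, so the quotient is block lower
     triangular. *)
  have : (row_span (T' k *m Phi k *m invmx T) d <= row_span (1%:M : 'M[K]_n) d)%VS.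
    by rewrite -(mulmxV unitT) row_spanMr // ((R_flag_eqP _ _ _).1 (eqT k)).
  by move=> /row_span1P h; rewrite /P mxE h ?mulr0.
have evalQ k : map_mx (meval x) (Q k) = Phi k.
  rewrite !map_mxM map_mx_adj evalP.
  rewrite (evalT _ _ (T' k)) //; last by move=> q; rewrite inE.
  rewrite (evalT _ _ T) //; last by move=> q; rewrite inE.
  have unitT' := reduced_unit (redT' k).
  rewrite -scalemxAr -scalemxAl -!mulmxA mulVmx // mulmx1 mulmxA mul_adj_mx.
  by rewrite mul_scalar_mx scalerA mulVf ?scale1r // -unitfE -unitmxE.
have := meval_coord_tuple Q p x; rewrite p_rel meval0 => /esym.
by congr (_ = _); apply: meval_eq => j; rewrite /tuple_coords; case: (enum_val j) => k [q1 q2];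
  rewrite evalQ.
Qed.

Lemma exists_vanishing_bad (w : 'I_s -> 'S_n) : (forall l, in_Wa a (w l)) ->
  (\sum_l perm_length (w l) + dim_flags n a <= s * dim_flags n a)%N ->
  exists2 p : {mpoly K[#|{: coord}|]}, p != 0 &
    forall Phi : 'I_s -> 'M[K]_n, (forall l, Phi l \in unitmx) ->
    ~ general_position a w (fun l => R_complete (Phi l)) -> p.@[tuple_coords Phi] = 0.
Proof.
move=> Waw le_dim.
pose small (vu : {ffun 'I_s -> 'S_n} * 'S_n) :=
  (perm_length vu.2 + \sum_k perm_length (vu.1 k) < s * dim_flags n a)%N.
have /boolp.choice[p pP] : forall vu, exists p : {mpoly K[#|{: coord}|]}, p != 0 /\ (small vu ->
    forall (Phi : 'I_s -> 'M[K]_n) (T : 'M[K]_n) (T' : 'I_s -> 'M[K]_n),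
    reduced vu.2 T -> (forall k, reduced (vu.1 k) (T' k)) ->
    (forall k, R_flag a (T' k *m Phi k) = R_flag a T) -> p.@[tuple_coords Phi] = 0).
  move=> vu; case: (boolP (small vu)) => [/exists_vanishing_cell[p nz_p p0]|_]; first by exists p.
  by exists 1; rewrite oner_eq0.
(* Finitely many pairs of cells occur; those that are not small contribute the factor chosen by
   default. *)
exists (\prod_vu p vu); first by apply/prodf_neq0 => vu _; have [] := pP vu.
move=> Phi unitPhi not_gp.
have [V [V_X neq_dim]] : exists V, (forall i, schubert_variety a (w i) (R_complete (Phi i)) V) /\
    ~ forall i (m : 'I_(size a)) (j : 'I_n),
      \dim (V m :&: R_complete (Phi i) j) = rk (w i) (nth 0%N a m) j.+1.
  by apply: contrapT => h; apply: not_gp => V V_X; apply: contrapT => h'; apply: h; exists V.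
have /boolp.choice[vT vTP] : forall k, exists vT : 'S_n * 'M[K]_n,
    [/\ in_Wa a vT.1, reduced vT.1 vT.2 & V = R_flag a (vT.2 *m Phi k)].
  move=> k; have [partV _] := V_X k.
  by have [v [T h]] := exists_reduced_flag flag_a (unitPhi k) partV; exists (v, T).
have [k0 neq_k0] : exists k, (vT k).1 != w k.
  apply: contrapT => all_eq; apply: neq_dim => i m j; have [_ redT ->] := vTP i.
  rewrite (dim_R_flag_cap _ _ redT) //; suff -> : (vT i).1 = w i by [].
  by apply/eqP; apply: contrapT => /negP neq_i; apply: all_eq; exists i.
have partV : partial_flag a V by have [] := V_X k0.
have [u [T [Wau redT def_V]]] := exists_reduced_span flag_a partV.
pose vu : {ffun 'I_s -> 'S_n} * 'S_n := ([ffun k => (vT k).1], u).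
have le_vw k : (perm_length (vT k).1 <= perm_length (w k))%N /\
    ((vT k).1 != w k -> perm_length (vT k).1 < perm_length (w k))%N.
  have [Wav redT' def_V'] := vTP k; have := V_X k; rewrite def_V'.
  by case/(schubert_reduced_le flag_a redT' (unitPhi k) Wav)=> [->|lt]; rewrite ?eqxx // ltnW.
(* The cell at [k0] is strictly smaller than that of w, and u costs at most dim(a). *)
have small_vu : small vu.
  apply: leq_trans le_dim; rewrite addnC -addSn; apply: leq_add; last exact: perm_length_le_dim.
  rewrite (bigD1 k0) // [X in (_ <= X)%N](bigD1 k0) //= -addSn ffunE.
  apply: leq_add; first by have [_] := le_vw k0; apply.
  by apply: leq_sum => k _; rewrite ffunE; have [] := le_vw k.
rewrite rmorph_prod (bigD1 vu) //=; have [_ /(_ small_vu) p0] := pP vu.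
rewrite (p0 Phi T (fun k => (vT k).2)) ?mul0r // => k; have [_ redT' def_V'] := vTP k.
  by rewrite ffunE.
by rewrite -def_V'.
Qed.

End Genericity.

Lemma R_complete_complete (K : fieldType) n (Phi : 'M[K]_n) : Phi \in unitmx ->
  complete_flag (R_complete Phi).
Proof.
move=> unitPhi; split=> [j|i j le_ij]; last exact: row_spanS.
by rewrite dim_row_span ?row_free_unit.
Qed.

Lemma complete_flag_R_complete (K : fieldType) n (F : subspaces K n n) : complete_flag F ->
  exists2 Phi, Phi \in unitmx & F = R_complete Phi.
Proof.
move=> [dimF F_mono]; have [|w [T [redT T_F _]]] := @exists_reduced _ _ F.
  by move=> i; rewrite dimF.
have unitT := reduced_unit redT; exists T => //; apply/funext => j; apply/esym/eqP.
rewrite eqEdim dimF dim_row_span ?row_free_unit // leqnn andbT.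
by apply/row_span_subP => i le_ij; apply: (subvP (F_mono i j le_ij)).
Qed.

(** * Openness and density of the general flags *)

Section GenericFlags.
Variables (K : numFieldType) (n : nat) (a : seq nat) (s : nat) (w : 'I_s -> 'S_n).
Notation coord := ('I_s * ('I_n * 'I_n))%type.

Definition vanishing : set {mpoly K[#|{: coord}|]} := [set p | forall Phi : 'I_s -> 'M[K]_n,
  (forall l, Phi l \in unitmx) -> ~ general_position a w (fun l => R_complete (Phi l)) ->
  p.@[tuple_coords Phi] = 0]%classic.

(** The complement of the Zariski closure of the bad tuples, pushed down to flags. *)
Definition generic_flags : set ('I_s -> subspaces K n n) :=
  [set F | exists Phi : 'I_s -> 'M[K]_n, [/\ forall l, Phi l \in unitmx,
    F = (fun l => R_complete (Phi l)) & exists2 p, vanishing p & p.@[tuple_coords Phi] != 0]]%classic.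

Lemma generic_flags_general_position F : generic_flags F -> general_position a w F.
Proof.
move=> [Phi [unitPhi -> [p p_van nz_p]]]; apply: contrapT => /(p_van Phi unitPhi) p0.
by rewrite p0 eqxx in nz_p.
Qed.

Lemma zariski_open_generic_flags : zariski_open generic_flags.
Proof.
split; first by move=> _ [Phi [unitPhi -> _]] l; apply: R_complete_complete.
exists vanishing => Phi unitPhi; split=> [[Phi' [unitPhi' eqR [p p_van nz_p]]]|];
  last by exists Phi.
(* Two matrix tuples with the same flags differ by b; substituting b into p gives a polynomial that
   still vanishes on bad tuples, because multiplication by b changes no flag. *)
pose b l := Phi' l *m invmx (Phi l).
pose Q l : 'M[{mpoly K[#|{: coord}|]}]_n := map_mx (@mpolyC _ K) (b l) *m generic_mx K n l.
have evalQ (Psi : 'I_s -> 'M[K]_n) :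
    (p \mPo coord_tuple Q).@[tuple_coords Psi] = p.@[tuple_coords (fun l => b l *m Psi l)].
  rewrite meval_coord_tuple; congr (p.@[tuple_coords _]); apply/funext => l.
  rewrite map_mxM map_generic_mx tuple_coordsK; congr (_ *m _).
  by apply/matrixP => i j; rewrite [LHS]mxE /= [X in meval _ X]mxE mevalC.
exists (p \mPo coord_tuple Q).
  move=> Psi unitPsi not_gp; rewrite evalQ; apply: p_van => [l|].
    by rewrite !unitmx_mul unitmx_inv unitPhi unitPhi' unitPsi.
  suff -> : (fun l => R_complete (b l *m Psi l)) = (fun l => R_complete (Psi l)) by [].
  apply/funext => l; apply/funext => j; rewrite /R_complete -[in RHS](mul1mx (Psi l)).
  rewrite -(mulmxV (unitPhi l)); do 2! apply: eq_row_spanMr.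
  by have /(congr1 (fun R => R l j)) := esym eqR.
rewrite evalQ; congr (_ != 0): nz_p; congr (p.@[tuple_coords _]); apply/funext => l.
by rewrite mulmxKV.
Qed.

Lemma zariski_dense_generic_flags :
  (exists2 p, p != 0 & vanishing p) -> zariski_dense generic_flags.
Proof.
move=> [p0 nz_p0 p0_van] O [O_complete [P OP]] [F OF].
have /boolp.choice[Psi PsiP] : forall l, exists Psi : 'M[K]_n,
    Psi \in unitmx /\ F l = R_complete Psi.
  move=> l; have [Psi unitPsi eqF] := complete_flag_R_complete (O_complete F OF l).
  by exists Psi.
have unitPsi l : Psi l \in unitmx by have [] := PsiP l.
have [q Pq nz_q] : exists2 p, P p & p.@[tuple_coords Psi] != 0.
  apply/(OP Psi unitPsi); rewrite (_ : (fun i => _) = F) //.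
  by apply/funext => l; have [_ ->] := PsiP l.
pose D : {mpoly K[#|{: coord}|]} := \prod_l \det (generic_mx K n l).
(* The factors ensure membership in O, general position and invertibility. *)
have [|x nz_x] := @exists_meval_neq0 K _ (q * p0 * D).
  rewrite !mulf_neq0 //; last by apply/prodf_neq0 => l _; apply: det_generic_mx_neq0.
  by apply: contraNneq nz_q => ->; rewrite meval0.
move: nz_x; rewrite !mevalM !mulf_eq0 !negb_or rmorph_prod => /andP[/andP[nz_qx nz_px] /prodf_neq0 nz_D].
pose Phi := mx_of_coords x.
have unitPhi l : Phi l \in unitmx.
  by rewrite unitmxE unitfE /Phi -map_generic_mx det_map_mx nz_D.
have coordsPhi p : p.@[tuple_coords Phi] = p.@[x] by apply/meval_eq/mx_of_coordsK.
exists (fun l => R_complete (Phi l)); split.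
  by apply/(OP Phi unitPhi); exists q; rewrite // coordsPhi.
by exists Phi; split=> //; exists p0; rewrite // coordsPhi.
Qed.

End GenericFlags.

Local Open Scope classical_set_scope.

Theorem theorem4p6 (R : realType) (n : nat) (a : seq nat) (r : nat)
    (w : 'I_r.+1 -> 'S_n) :
  flag_dims n a ->
  schubert_problem a w ->
  exists U : set ('I_r.+1 -> subspaces R[i] n n),
    [/\ zariski_open U, zariski_dense U &
    forall (F : 'I_r.+1 -> subspaces R[i] n n) (Phi : 'I_r.+1 -> 'M[R[i]]_n),
      U F ->
      (forall i, Phi i \in unitmx) ->
      (forall i, F i = R_complete (Phi i)) ->
      [/\ set_bij (common_zeroes a w Phi)
            (\bigcap_(i in [set: 'I_r.+1]) schubert_variety a (w i) (F i))
            (fun x => R_flag a (x.1 *m Phi ord_max)),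
          #|equations n a r| = (r * dim_flags n a)%N,
          #|variables a w| = (r * dim_flags n a)%N,
          (forall y : entry_position n a r -> R[i],
             exists! x, local_coordinates a w x /\
               {in variables a w, entry x =1 y}) &
          (forall e, e \in equations n a r ->
             (forall N, scalar (fun M => equation_lhs a Phi e M N)) /\
             (forall M, scalar (equation_lhs a Phi e M)))]].
Proof.
move=> flag_a schub; have [Waw _] := schub.
exists (@generic_flags R[i] n a r.+1 w); split; first exact: zariski_open_generic_flags.
  apply: zariski_dense_generic_flags.
  have [|p nz_p p_van] := @exists_vanishing_bad R[i] n a _ flag_a w Waw; last by exists p.
  (* For s = r + 1 the bound on lengths is an equality. *)
  by rewrite (sum_perm_length flag_a schub) mulSn addnC.
move=> F Phi UF unitPhi eqF.
have {}eqF : F = (fun l => R_complete (Phi l)) by apply/funext.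
have gp_w : general_position a w (fun l => R_complete (Phi l)).
  by rewrite -eqF; apply: generic_flags_general_position.
split.
- by rewrite eqF; apply: common_zeroes_bij.
- exact: card_equations.
- exact: card_variables.
- exact: exists_unique_coordinates.
- move=> e _; split=> [N|M] c A B; rewrite /equation_lhs.
    by rewrite !mulmxDl -!scalemxAl !mxE.
  by rewrite mulmxDr -scalemxAr !mxE.
Qed.
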